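(* Let $r_0>0$, $\varepsilon_0>0$, and let $e_{(\cdot)}:[0,\varepsilon_0]\to \mathscr{E}^2$, $m\mapsto e_m$, be a continuous curve which is differentiable at $m=0$ and satisfies $e_0=0$. On the manifold with boundary $M=\mathbb{R}^3\setminus B_{r_0}$ consider the one-parameter family of metrics \[ g^{m,e_m}_{ij}(x)=\Big(1+\frac{m}{2|x|}\Big)^4\delta_{ij}+(e_m(x))_{ij},\qquad m\in[0,\varepsilon_0]. \] Then there exists $\bar c\geq r_0$ such that it is NOT possible to find simultaneously: (i) a continuous curve $\Omega_{(\cdot)}:[0,\varepsilon_0]\to \mathscr{C}^2_b(S^1\times\mathbb{R})$, $m\mapsto\Omega_m$, differentiable at $m=0$, with $\Omega_0=0$, and such that for each $m\in[0,\varepsilon_0]$ one has $\Omega_m(u,v)\to 0$ as $v\to\pm\infty$; (ii) sequences $m_i\downarrow 0$ with $0<m_i<\varepsilon_0$ and $c_i\geq \bar c$, such that for every $i$ the perturbed catenoidal immersion $F^{\Omega_{m_i}}_{c_i}:S^1\times\mathbb{R}\to M$ is a minimal immersion (i.e. has identically vanishing mean curvature) in $(M,g^{m_i,e_{m_i}})$.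
   Context: For $r_0>0$, $\mathscr{E}^k$ denotes the Banach space of maps $e:\mathbb{R}^3\setminus B_{r_0}\to\{\text{symmetric real }3\times 3\text{ matrices}\}$ of class $C^k$ with finite norm $\|e\|_{\mathscr{E}^k}=\sum_{i,j=1}^3\sum_{|\alpha|\le k}\sup_{|x|\ge r_0}|\partial^\alpha e_{ij}(x)|\,|x|^{2+|\alpha|}$. $\mathscr{C}^k_b(S^1\times\mathbb{R})$ denotes the Banach space of $C^k$ functions $f$ on $S^1\times\mathbb{R}$ (coordinates $(u,v)$) with finite norm $\sum_{|\alpha|\le k}\sup_{S^1\times\mathbb{R}}|\nabla^\alpha f|$. For $c>0$, the catenoid of neck $c$ with vertical axis is parametrized by $F_c(u,v)=(c\cosh v\cos u,\,c\cosh v\sin u,\,cv)$, with unit normal $\mathbf{n}_{F_c}(u,v)=\cosh^{-1}(v)(\cos u,\sin u,-\sinh v)$. For a function $\Omega$ on $S^1\times\mathbb{R}$, the normal graph over this catenoid with defining function $\Omega$ is $F^\Omega_c=F_c+\Omega\,\mathbf{n}_{F_c}$, i.e. \[F^\Omega_c(u,v)=\Big(\big(c\cosh v+\tfrac{\Omega(u,v)}{\cosh v}\big)\cos u,\ \big(c\cosh v+\tfrac{\Omega(u,v)}{\cosh v}\big)\sin u,\ cv-\tanh(v)\,\Omega(u,v)\Big).\] *)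

(* Defs.v *)
From Stdlib Require Import Reals Lra List.
Open Scope R_scope.

Inductive idx : Set := i1 | i2 | i3.

Definition idx_eqb (a b : idx) : bool :=
  match a, b with
  | i1, i1 | i2, i2 | i3, i3 => true
  | _, _ => false
  end.

Definition R3 := idx -> R.
Definition Mat := idx -> idx -> R.

Definition sum3 (f : idx -> R) : R := f i1 + f i2 + f i3.

Definition norm3 (x : R3) : R := sqrt (sum3 (fun k => x k ^ 2)).
Definition dist3 (x y : R3) : R := norm3 (fun k => x k - y k).

Definition shift (x : R3) (i : idx) (h : R) : R3 :=
  fun j => if idx_eqb j i then x j + h else x j.

Definition Mdom (r0 : R) (x : R3) : Prop := r0 <= norm3 x.

(** Partial derivative d_i f (x) = l, taken within the domain D
    (one-sided where necessary, e.g. at boundary points of M). *)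
Definition partial_within (D : R3 -> Prop) (f : R3 -> R) (i : idx) (x : R3) (l : R)
  : Prop :=
  limit1_in (fun h => (f (shift x i h) - f x) / h)
            (fun h => h <> 0 /\ D (shift x i h)) l 0.

Definition cont_within3 (D : R3 -> Prop) (f : R3 -> R) (x : R3) : Prop :=
  forall eps, 0 < eps -> exists d, 0 < d /\
    forall y, D y -> dist3 y x < d -> Rabs (f y - f x) < eps.

(** [C2_within D f Df]: f is C^2 on D, and [Df a] is the iterated partial
    derivative d_{a_1} d_{a_2} ... f along the (ordered) list of directions
    [a] (length <= 2); [Df (i :: a) = d_i (Df a)]. *)
Definition C2_within (D : R3 -> Prop) (f : R3 -> R) (Df : list idx -> R3 -> R)
  : Prop :=
  (forall x, D x -> Df nil x = f x) /\
  (forall a i x, (length a <= 1)%nat -> D x ->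
      partial_within D (Df a) i x (Df (i :: a) x)) /\
  (forall a x, (length a <= 2)%nat -> D x -> cont_within3 D (Df a) x).

Definition wE (r0 : R) (De : list idx -> R3 -> Mat) (a : list idx) (x : R3)
  (i j : idx) : R :=
  Rabs (De a x i j) * norm3 x ^ (2 + length a).

Definition is_E2 (r0 : R) (e : R3 -> Mat) (De : list idx -> R3 -> Mat) : Prop :=
  (forall i j, C2_within (Mdom r0) (fun x => e x i j) (fun a x => De a x i j)) /\
  (forall x i j, Mdom r0 x -> e x i j = e x j i) /\
  (exists K, forall a x i j, (length a <= 2)%nat -> Mdom r0 x ->
      wE r0 De a x i j <= K).

(** Continuity of m |-> e_m in E^2 norm on [0,eps0]
    (norm convergence = uniform convergence of all weighted terms). *)
Definition E2_curve_continuous (r0 eps0 : R) (De : R -> list idx -> R3 -> Mat)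
  : Prop :=
  forall m, 0 <= m <= eps0 -> forall eps, 0 < eps -> exists d, 0 < d /\
    forall m', 0 <= m' <= eps0 -> Rabs (m' - m) < d ->
      forall a x i j, (length a <= 2)%nat -> Mdom r0 x ->
        wE r0 (fun b y => fun k l => De m' b y k l - De m b y k l) a x i j <= eps.

Definition E2_curve_diff_at0 (r0 eps0 : R) (De : R -> list idx -> R3 -> Mat)
  : Prop :=
  exists De' : list idx -> R3 -> Mat,
    is_E2 r0 (De' nil) De' /\
    forall eps, 0 < eps -> exists d, 0 < d /\
      forall m, 0 < m -> m <= eps0 -> m < d ->
        forall a x i j, (length a <= 2)%nat -> Mdom r0 x ->
          wE r0 (fun b y => fun k l =>
                   (De m b y k l - De 0 b y k l) / m - De' b y k l) a x i j <= eps.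

(** * Functions on S^1 x R, coordinates (u,v); direction false = u, true = v *)
Definition partial2 (f : R -> R -> R) (d : bool) (u v l : R) : Prop :=
  if d then derivable_pt_lim (fun t => f u t) v l
  else derivable_pt_lim (fun t => f t v) u l.

Definition cont2 (f : R -> R -> R) (u v : R) : Prop :=
  forall eps, 0 < eps -> exists d, 0 < d /\
    forall u' v', Rabs (u' - u) < d -> Rabs (v' - v) < d ->
      Rabs (f u' v' - f u v) < eps.

(** f, viewed as 2*PI-periodic in u, is in C^2_b(S^1 x R) with derivatives Df. *)
Definition Cb2 (f : R -> R -> R) (Df : list bool -> R -> R -> R) : Prop :=
  (forall u v, f (u + 2 * PI) v = f u v) /\
  (forall u v, Df nil u v = f u v) /\
  (forall a d u v, (length a <= 1)%nat -> partial2 (Df a) d u v (Df (d :: a) u v)) /\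
  (forall a u v, (length a <= 2)%nat -> cont2 (Df a) u v) /\
  (exists K, forall a u v, (length a <= 2)%nat -> Rabs (Df a u v) <= K).

Definition Cb2_curve_continuous (eps0 : R) (DOm : R -> list bool -> R -> R -> R)
  : Prop :=
  forall m, 0 <= m <= eps0 -> forall eps, 0 < eps -> exists d, 0 < d /\
    forall m', 0 <= m' <= eps0 -> Rabs (m' - m) < d ->
      forall a u v, (length a <= 2)%nat ->
        Rabs (DOm m' a u v - DOm m a u v) <= eps.

Definition Cb2_curve_diff_at0 (eps0 : R) (DOm : R -> list bool -> R -> R -> R)
  : Prop :=
  exists DOm' : list bool -> R -> R -> R,
    Cb2 (DOm' nil) DOm' /\
    forall eps, 0 < eps -> exists d, 0 < d /\
      forall m, 0 < m -> m <= eps0 -> m < d ->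
        forall a u v, (length a <= 2)%nat ->
          Rabs ((DOm m a u v - DOm 0 a u v) / m - DOm' a u v) <= eps.

Definition decays_at_ends (f : R -> R -> R) : Prop :=
  forall u eps, 0 < eps -> exists V,
    forall v, V < Rabs v -> Rabs (f u v) < eps.

Definition kron (i j : idx) : R := if idx_eqb i j then 1 else 0.

Definition metric (m : R) (e : R3 -> Mat) : R3 -> Mat :=
  fun x i j => (1 + m / (2 * norm3 x)) ^ 4 * kron i j + e x i j.

(** * Perturbed catenoid F^Omega_c = F_c + Omega n_{F_c} *)
Definition catenoid_graph (c : R) (Om : R -> R -> R) : R -> R -> R3 :=
  fun u v k =>
    match k with
    | i1 => (c * cosh v + Om u v / cosh v) * cos u
    | i2 => (c * cosh v + Om u v / cosh v) * sin u
    | i3 => c * v - tanh v * Om u v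
    end.

Definition bilin (G : Mat) (X Y : R3) : R :=
  sum3 (fun i => sum3 (fun j => G i j * X i * Y j)).

Definition cross (X Y : R3) : R3 :=
  fun k => match k with
  | i1 => X i2 * Y i3 - X i3 * Y i2
  | i2 => X i3 * Y i1 - X i1 * Y i3
  | i3 => X i1 * Y i2 - X i2 * Y i1
  end.

(** Christoffel symbols of the first kind Gamma_{k,ij} at a point, from
    G = (g_ij) and dG k i j = d_k g_ij. *)
Definition Gam1 (dG : idx -> Mat) (k i j : idx) : R :=
  / 2 * (dG i k j + dG j k i - dG k i j).

(** g(X, nabla_{d_a} d_b F) with A = d_a F, B = d_b F, C = d_a d_b F. *)
Definition acc_low (G : Mat) (dG : idx -> Mat) (X A B C : R3) : R :=
  sum3 (fun k => X k *
     (sum3 (fun l => G k l * C l)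
      + sum3 (fun i => sum3 (fun j => Gam1 dG k i j * A i * B j)))).

(** The mean curvature vector h^{ab} (nabla_{d_a} d_b F)^perp vanishes:
    its pairing with every g-normal vector X is zero. *)
Definition mean_curv_vanishes (G : Mat) (dG : idx -> Mat)
  (Fu Fv Fuu Fuv Fvu Fvv : R3) : Prop :=
  let h11 := bilin G Fu Fu in
  let h12 := bilin G Fu Fv in
  let h22 := bilin G Fv Fv in
  let det := h11 * h22 - h12 * h12 in
  forall X : R3, bilin G X Fu = 0 -> bilin G X Fv = 0 ->
    (h22 / det) * acc_low G dG X Fu Fu Fuu
    + (- h12 / det) * acc_low G dG X Fu Fv Fuv
    + (- h12 / det) * acc_low G dG X Fv Fu Fvu
    + (h11 / det) * acc_low G dG X Fv Fv Fvv = 0.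

Definition minimal_immersion (r0 : R) (g : R3 -> Mat) (F : R -> R -> R3) : Prop :=
  (forall u v, Mdom r0 (F u v)) /\
  exists DF : list bool -> R -> R -> R3,
    (forall u v, DF nil u v = F u v) /\
    (forall a d u v k, (length a <= 1)%nat ->
        partial2 (fun s t => DF a s t k) d u v (DF (d :: a) u v k)) /\
    (forall a u v k, (length a <= 2)%nat -> cont2 (fun s t => DF a s t k) u v) /\
    (forall u v, cross (DF (false :: nil) u v) (DF (true :: nil) u v) <> (fun _ => 0)) /\
    (forall u v, exists dG : idx -> Mat,
       (forall k i j, partial_within (Mdom r0) (fun x => g x i j) k (F u v) (dG k i j)) /\
       mean_curv_vanishes (g (F u v)) dG
         (DF (false :: nil) u v) (DF (true :: nil) u v)
         (DF (false :: false :: nil) u v) (DF (false :: true :: nil) u v)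
         (DF (true :: false :: nil) u v) (DF (true :: true :: nil) u v)).

(* Main.v *)
(** The mean curvature equation of the graph is tested against the Jacobi
    function [1 - v tanh v] generated by dilations of the catenoid.  To first
    order, minimality reads [Delta Om + 2 sech^2 v Om = - 2 m w + O(m / c) + O(m^2)],
    where the Schwarzschild term [w] is a positive multiple of [1 - v tanh v] that
    does not decay as the neck [c] grows, whereas the contribution of [e_m] is
    [O(m / c)].  Averaging in [u], the Wronskian of the mean of [Om] with
    [1 - v tanh v] tends to [0] along sequences going to both ends because [Om]
    decays, so the integral of the tested equation vanishes.  For [c] large,
    depending only on the size of [e_m / m], and then [m] small, the Schwarzschild
    contribution has a strict sign and dominates, which is impossible. All error
    terms are controlled uniformly in [c], so one index of the sequence suffices. *)

(* Uniformity in [c] comes from using the unit frame of the catenoid and measuring lengths in units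
   of [s = c * cosh v]. The catenoid then has unit tangent vectors for all [c] and [v], [Om] and its
   derivatives are [O(m / s)], and [e_m] with its rescaled first derivatives is [O(m / s ^ 2)]. A
   first-order expansion has error [O(m ^ 2 / s ^ 2 + m / s ^ 2)]. Undoing the scaling costs one
   factor [s], and [/ s = sech v / c] gives both smallness for large [c] and enough decay in [v] to
   integrate against a linearly growing test function. The test function fits the metric: the
   Schwarzschild factor has a radial gradient, whose product with the catenoid normal is the normal
   component of the position vector, which is the dilation Jacobi function. The tested term is thus
   a square with a sign at every [v], and its size is only quantified on [0 <= v <= / 2]. [cbar] is
   fixed before [Om] is known, so constants depending on [Om] may enter only with a further factor
   [m], whereas the contribution of [e_m] must be beaten by [c] alone. *)
Require Import Defs.
From Stdlib Require Import Reals Lra Lia List FunctionalExtensionality.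
From Coquelicot Require Import Coquelicot.
Open Scope R_scope.

(** * First-order expansion of the mean curvature *)


(* [f] is [f0 + f1] with [f0] bounded and [f1] of size [d], up to an error of size
   [th]; as [d ^ 2 <= th], products multiply like dual numbers. *)
Definition jet (d th C f f0 f1 : R) : Prop :=
  0 <= C /\ Rabs f0 <= C /\ Rabs f1 <= C * d /\ Rabs (f - (f0 + f1)) <= C * th.

Lemma jet_plus d th C C' f f0 f1 g g0 g1 :
  jet d th C f f0 f1 -> jet d th C' g g0 g1 ->
  jet d th (C + C') (f + g) (f0 + g0) (f1 + g1).
Proof.
  intros (H & H0 & H1 & H2) (K & K0 & K1 & K2).
  repeat split; [lra | | |].
  - eapply Rle_trans; [apply Rabs_triang | lra].
  - eapply Rle_trans; [apply Rabs_triang | lra].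
  - replace (f + g - (f0 + g0 + (f1 + g1)))
      with ((f - (f0 + f1)) + (g - (g0 + g1))) by ring.
    eapply Rle_trans; [apply Rabs_triang | lra].
Qed.

Lemma jet_opp d th C f f0 f1 : jet d th C f f0 f1 -> jet d th C (- f) (- f0) (- f1).
Proof.
  intros (H & H0 & H1 & H2).
  repeat split; rewrite ?Rabs_Ropp; try assumption.
  replace (- f - (- f0 + - f1)) with (- (f - (f0 + f1))) by ring.
  now rewrite Rabs_Ropp.
Qed.

Lemma jet_minus d th C C' f f0 f1 g g0 g1 :
  jet d th C f f0 f1 -> jet d th C' g g0 g1 ->
  jet d th (C + C') (f - g) (f0 - g0) (f1 - g1).
Proof. intros H K. apply jet_plus; [assumption | now apply jet_opp]. Qed.

Lemma Rabs_mult_le x y a b : Rabs x <= a -> Rabs y <= b -> Rabs (x * y) <= a * b.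
Proof.
  intros. rewrite Rabs_mult. apply Rmult_le_compat; auto using Rabs_pos.
Qed.

(** The constant 6 counts the products left over beyond first order. Each is at most [C * C' * th]:
    [f1 * g1] because [d * d <= th], those containing a remainder because [d] and [th] are at most
    1. *)
Lemma jet_mult d th C C' f f0 f1 g g0 g1 :
  0 <= d <= 1 -> 0 <= th <= 1 -> d * d <= th ->
  jet d th C f f0 f1 -> jet d th C' g g0 g1 ->
  jet d th (6 * C * C') (f * g) (f0 * g0) (f0 * g1 + f1 * g0).
Proof.
  intros Hd Hth Hdt (H & H0 & H1 & H2) (K & K0 & K1 & K2).
  assert (P : 0 <= C * C') by (apply Rmult_le_pos; assumption).
  assert (Pt : 0 <= C * C' * th) by (apply Rmult_le_pos; lra).
  assert (Pd : 0 <= C * C' * d) by (apply Rmult_le_pos; lra).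
  repeat split; [lra | | |].
  - generalize (Rabs_mult_le _ _ _ _ H0 K0); lra.
  - eapply Rle_trans; [apply Rabs_triang |].
    generalize (Rabs_mult_le _ _ _ _ H0 K1) (Rabs_mult_le _ _ _ _ H1 K0); lra.
  - set (r := f - (f0 + f1)) in *. set (r' := g - (g0 + g1)) in *.
    replace (f * g - (f0 * g0 + (f0 * g1 + f1 * g0)))
      with (f1 * g1 + r * g0 + r * g1 + r * r' + f0 * r' + f1 * r')
      by (unfold r, r'; ring).
    generalize (Rabs_mult_le _ _ _ _ H1 K1) (Rabs_mult_le _ _ _ _ H2 K0)
      (Rabs_mult_le _ _ _ _ H2 K1) (Rabs_mult_le _ _ _ _ H2 K2)
      (Rabs_mult_le _ _ _ _ H0 K2) (Rabs_mult_le _ _ _ _ H1 K2).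
    intros A1 A2 A3 A4 A5 A6.
    assert (C * C' * (d * d) <= C * C' * th) by (apply Rmult_le_compat_l; lra).
    assert (C * C' * th * d <= C * C' * th * 1) by (apply Rmult_le_compat_l; lra).
    assert (C * C' * th * th <= C * C' * th * 1) by (apply Rmult_le_compat_l; lra).
    generalize (Rabs_triang (f1 * g1 + r * g0 + r * g1 + r * r' + f0 * r') (f1 * r'))
      (Rabs_triang (f1 * g1 + r * g0 + r * g1 + r * r') (f0 * r'))
      (Rabs_triang (f1 * g1 + r * g0 + r * g1) (r * r'))
      (Rabs_triang (f1 * g1 + r * g0) (r * g1)) (Rabs_triang (f1 * g1) (r * g0)).
    lra.
Qed.

Lemma jet_const d th C x : 0 <= d -> 0 <= th -> Rabs x <= C -> jet d th C x x 0.
Proof.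
  intros Hd Ht H. pose proof (Rabs_pos x).
  repeat split; [lra | lra | rewrite Rabs_R0; apply Rmult_le_pos; lra |].
  replace (x - (x + 0)) with 0 by ring.
  rewrite Rabs_R0. apply Rmult_le_pos; lra.
Qed.

Lemma jet_weaken d th C C' f f0 f1 g0 g1 :
  0 <= d -> 0 <= th -> jet d th C f f0 f1 -> f0 = g0 -> f1 = g1 -> C <= C' ->
  jet d th C' f g0 g1.
Proof.
  intros Hd Ht (H & H0 & H1 & H2) <- <- HC.
  assert (C * d <= C' * d) by (apply Rmult_le_compat_r; lra).
  assert (C * th <= C' * th) by (apply Rmult_le_compat_r; lra).
  repeat split; lra.
Qed.

Definition triple (x y z : R) : R3 :=
  fun k => match k with i1 => x | i2 => y | i3 => z end.

Definition mat_vec (G : Mat) (X : R3) : R3 := fun i => sum3 (fun j => G i j * X j).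

(** Descends through the arithmetic with the constant and both parts left as unification variables;
    [jets_by] then compares the result with the announced jet by [jet_weaken]. *)
Ltac jets := repeat first
  [ eassumption
  | match goal with
    | |- jet _ _ _ (_ + _) _ _ => eapply jet_plus
    | |- jet _ _ _ (_ - _) _ _ => eapply jet_minus
    | |- jet _ _ _ (- _) _ _ => eapply jet_opp
    | |- jet _ _ _ (_ * _) _ _ => eapply jet_mult; [eassumption | eassumption | eassumption | |]
    | H : forall i j, jet _ _ _ (?g i j) _ _ |- jet _ _ _ (?g _ _) _ _ => eapply H
    | H : forall i j k, jet _ _ _ (?g i j k) _ _ |- jet _ _ _ (?g _ _ _) _ _ => eapply H
    | H : forall i, jet _ _ _ (?g i) _ _ |- jet _ _ _ (?g _) _ _ => eapply H
    | |- jet _ _ _ 0 _ _ => apply (jet_const _ _ 0); [lra | lra | rewrite Rabs_R0; lra]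
    | |- jet _ _ _ (/ 2) _ _ => apply (jet_const _ _ 1); [lra | lra | rewrite Rabs_pos_eq; lra]
    end ].

Ltac jets_by := eapply jet_weaken; [lra | lra | jets | try (cbn; ring) | try (cbn; ring) | try lra].

Section Expansion.
Variables (d th tau : R) (g : Mat) (P : R3) (dg : idx -> Mat).
Variables (A B : R3).
Hypothesis Hd : 0 <= d <= 1.
Hypothesis Hth : 0 <= th <= 1.
Hypothesis Hdt : d * d <= th.
Hypothesis Hg : forall i j, jet d th 1 (g i j) (kron i j) (tau * kron i j).
Hypothesis Hdg : forall a b c, jet d th 1 (dg a b c) 0 (P a * kron b c).
Variables (S om p q : R).
Hypothesis HA : forall i, jet d th 1 (A i) (triple 1 0 0 i) (triple (om * S) 0 p i).
Hypothesis HB : forall i, jet d th 1 (B i) (triple 0 1 0 i) (triple 0 (- (om * S)) q i).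

Lemma jet_gA i : jet d th 18 (mat_vec g A i) (triple 1 0 0 i) (triple (tau + om * S) 0 p i).
Proof. unfold mat_vec, sum3. destruct i; jets_by. Qed.

Lemma jet_gB i : jet d th 18 (mat_vec g B i) (triple 0 1 0 i) (triple 0 (tau - om * S) q i).
Proof. unfold mat_vec, sum3. destruct i; jets_by. Qed.

(* Normal to [A] and [B] for the bilinear form [g], so it is an admissible test
   vector in [mean_curv_vanishes]. *)
Definition gnormal := cross (mat_vec g A) (mat_vec g B).

Lemma jet_normal i : jet d th 3888 (gnormal i) (triple 0 0 1 i) (triple (- p) (- q) (2 * tau) i).
Proof. pose proof jet_gA. pose proof jet_gB. unfold gnormal, cross. destruct i; jets_by. Qed.

Lemma jet_h11 : jet d th 400 (bilin g A A) 1 (tau + 2 * om * S).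
Proof. unfold bilin, sum3. jets_by. Qed.
Lemma jet_h12 : jet d th 400 (bilin g A B) 0 0.
Proof. unfold bilin, sum3. jets_by. Qed.
Lemma jet_h22 : jet d th 400 (bilin g B B) 1 (tau - 2 * om * S).
Proof. unfold bilin, sum3. jets_by. Qed.

Lemma jet_Gam1 k i j :
  jet d th 18 (Gam1 dg k i j) 0 (/ 2 * (P i * kron k j + P j * kron k i - P k * kron i j)).
Proof. unfold Gam1. jets_by. Qed.

(** In [3 * tau], one [tau] comes from lowering the index with [g] and two from the third component
    of the normal; its tangential corrections [- p] and [- q] pick up the zeroth-order tangential
    acceleration. *)
Lemma jet_acc X1 X2 X10 X20 X11 X21 C C0 C1 :
  (forall i, jet d th 1 (X1 i) (X10 i) (X11 i)) ->
  (forall i, jet d th 1 (X2 i) (X20 i) (X21 i)) ->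
  (forall i, jet d th 3 (C i) (C0 i) (C1 i)) ->
  jet d th 2000000000 (acc_low g dg gnormal X1 X2 C)
    (C0 i3)
    (C1 i3 + 3 * tau * C0 i3 - p * C0 i1 - q * C0 i2
     + sum3 (fun i => sum3 (fun j =>
         / 2 * (P i * kron i3 j + P j * kron i3 i - P i3 * kron i j) * X10 i * X20 j))).
Proof.
  intros H1 H2 H3. pose proof jet_normal. pose proof jet_Gam1.
  unfold acc_low.
  assert (HG : forall k, jet d th 18000 
     (sum3 (fun l => g k l * C l)
      + sum3 (fun i => sum3 (fun j => Gam1 dg k i j * X1 i * X2 j)))
     (C0 k) (C1 k + tau * C0 k + sum3 (fun i => sum3 (fun j =>
         / 2 * (P i * kron k j + P j * kron k i - P k * kron i j) * X10 i * X20 j)))).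
  { intros k. unfold sum3. destruct k; jets_by. }
  unfold sum3 at 1. 
  eapply jet_weaken; [lra | lra | | | |].
  { eapply jet_plus; [eapply jet_plus|];
      (eapply jet_mult; [eassumption | eassumption | eassumption | apply jet_normal | apply HG]). }
  - cbn; ring.
  - cbn; ring.
  - lra.
Qed.
End Expansion.

Lemma bilin_gnormal_l (g : Mat) (A B : R3) : bilin g (gnormal g A B) A = 0.
Proof. unfold gnormal, bilin, cross, mat_vec, sum3. ring. Qed.

Lemma bilin_gnormal_r (g : Mat) (A B : R3) : bilin g (gnormal g A B) B = 0.
Proof. unfold gnormal, bilin, cross, mat_vec, sum3. ring. Qed.

Lemma Rabs_le_1 x : -1 <= x <= 1 -> Rabs x <= 1.
Proof. intros. apply Rabs_le. lra. Qed.

(* The numerical constants are what the jet arithmetic yields; only their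
   independence of all the data matters. *)
Lemma mean_curv_expansion (d eps S T tau om p q uu uv vu vv : R)
  (g : Mat) (P : R3) (dg : idx -> Mat) :
  0 <= d -> 0 <= eps -> d + eps <= / 100000000 ->
  0 <= S <= 1 -> Rabs T <= 1 -> Rabs tau <= d -> (forall a, Rabs (P a) <= d) ->
  Rabs om <= d -> Rabs p <= d -> Rabs q <= d ->
  Rabs uu <= d -> Rabs uv <= d -> Rabs vu <= d -> Rabs vv <= d ->
  (forall i j, Rabs (g i j - (1 + tau) * kron i j) <= eps) ->
  (forall a b c, Rabs (dg a b c - P a * kron b c) <= eps) ->
  mean_curv_vanishes g dg (triple (1 + om * S) 0 p) (triple 0 (1 - om * S) q)
    (triple (2 * S * p) (- T * (1 + om * S)) (uu - S * (1 + om * S)))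
    (triple (T * (1 - om * S) + S * q) (- S * p) uv)
    (triple (T * (1 - om * S) + S * q) (- S * p) vu)
    (triple 0 (T * (1 + om * S) - 2 * S * q) (vv + S * (1 - om * S))) ->
  Rabs (uu + vv + 2 * (S * S) * om - P i3) <= 20000000000000 * (d * d + eps).
Proof.
  intros Hd He Hsm HS HT Htau HP Hom Hp Hq Huu Huv Hvu Hvv Hg Hdg Hmc.
  set (th := d * d + eps).
  assert (Hdd : 0 <= d * d) by (apply Rmult_le_pos; lra).
  assert (Hdd1 : d * d <= d) by (rewrite <- (Rmult_1_r d) at 3; apply Rmult_le_compat_l; lra).
  assert (Hd1 : 0 <= d <= 1) by lra.
  assert (Ht1 : 0 <= th <= 1) by (unfold th; lra).
  assert (Hdt : d * d <= th) by (unfold th; lra).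
  assert (Hk : forall i j, 0 <= kron i j <= 1)
    by (intros i j; unfold kron; destruct (idx_eqb i j); lra).
  assert (HSa : Rabs S <= 1) by (apply Rabs_le_1; lra).
  assert (HomS : Rabs (om * S) <= d)
    by (replace d with (d * 1) by ring; apply Rabs_mult_le; assumption).
  assert (HSp : Rabs (S * p) <= d)
    by (replace d with (1 * d) by ring; apply Rabs_mult_le; assumption).
  assert (HSq : Rabs (S * q) <= d)
    by (replace d with (1 * d) by ring; apply Rabs_mult_le; assumption).
  assert (HTos : Rabs (T * (om * S)) <= d)
    by (replace d with (1 * d) by ring; apply Rabs_mult_le; assumption).
  assert (HSos : Rabs (S * (om * S)) <= d)
    by (replace d with (1 * d) by ring; apply Rabs_mult_le; assumption).
  assert (Jg : forall i j, jet d th 1 (g i j) (kron i j) (tau * kron i j)).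
  { intros i j. repeat split; [lra | apply Rabs_le_1; generalize (Hk i j); lra | |].
    - rewrite Rmult_1_l, <- (Rmult_1_r d). apply Rabs_mult_le; [assumption |].
      apply Rabs_le_1; generalize (Hk i j); lra.
    - replace (g i j - (kron i j + tau * kron i j)) with (g i j - (1 + tau) * kron i j) by ring.
      unfold th. generalize (Hg i j); lra. }
  assert (Jdg : forall a b c, jet d th 1 (dg a b c) 0 (P a * kron b c)).
  { intros a b c. repeat split; [lra | rewrite Rabs_R0; lra | |].
    - rewrite Rmult_1_l, <- (Rmult_1_r d). apply Rabs_mult_le; [auto |].
      apply Rabs_le_1; generalize (Hk b c); lra.
    - rewrite Rplus_0_l. unfold th. generalize (Hdg a b c); lra. }
  assert (J2 : forall C f f0 f1, 0 <= C -> Rabs f0 <= C -> Rabs f1 <= C * d -> f = f0 + f1 ->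
     jet d th C f f0 f1).
  { intros C f f0 f1 H0 H1 H2 ->. repeat split; try assumption.
    rewrite Rminus_diag, Rabs_R0. apply Rmult_le_pos; lra. }
  assert (J0 : Rabs 0 <= d) by (rewrite Rabs_R0; lra).
  assert (J00 : Rabs 0 <= 1) by (rewrite Rabs_R0; lra).
  assert (J01 : Rabs 1 <= 1) by (rewrite Rabs_R1; lra).
  set (A := triple (1 + om * S) 0 p) in *.
  set (B := triple 0 (1 - om * S) q) in *.
  assert (JA : forall i, jet d th 1 (A i) (triple 1 0 0 i) (triple (om * S) 0 p i)).
  { intros []; apply J2; cbn; lra. }
  assert (JB : forall i, jet d th 1 (B i) (triple 0 1 0 i) (triple 0 (- (om * S)) q i)).
  { intros []; apply J2; cbn; rewrite ?Rabs_Ropp; lra. }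
  set (C11 := triple (2 * S * p) _ _) in Hmc.
  set (C12 := triple _ _ uv) in Hmc.
  set (C21 := triple _ _ vu) in Hmc.
  set (C22 := triple 0 _ _) in Hmc.
  assert (Htwo : forall x y, Rabs x <= d -> Rabs y <= d -> Rabs (x + y) <= 3 * d)
    by (intros; eapply Rle_trans; [apply Rabs_triang | lra]).
  assert (J11 : forall i, jet d th 3 (C11 i) (triple 0 (- T) (- S) i)
     (triple (S * p + S * p) (- (T * (om * S))) (uu + - (S * (om * S))) i)).
  { intros []; apply J2; cbn; rewrite ?Rabs_Ropp; try lra; try ring;
      try (apply Htwo; rewrite ?Rabs_Ropp; assumption). }
  assert (J12 : forall i, jet d th 3 (C12 i) (triple T 0 0 i)
     (triple (S * q + - (T * (om * S))) (- (S * p)) uv i)).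
  { intros []; apply J2; cbn; rewrite ?Rabs_Ropp; try lra; try ring;
      try (apply Htwo; rewrite ?Rabs_Ropp; assumption). }
  assert (J21 : forall i, jet d th 3 (C21 i) (triple T 0 0 i)
     (triple (S * q + - (T * (om * S))) (- (S * p)) vu i)).
  { intros []; apply J2; cbn; rewrite ?Rabs_Ropp; try lra; try ring;
      try (apply Htwo; rewrite ?Rabs_Ropp; assumption). }
  assert (J22 : forall i, jet d th 3 (C22 i) (triple 0 T S i)
     (triple 0 (T * (om * S) + (- (S * q) + - (S * q))) (vv + - (S * (om * S))) i)).
  { intros []; apply J2; cbn; rewrite ?Rabs_Ropp; try lra; try ring.
    - generalize (Rabs_triang (T * (om * S)) (- (S * q) + - (S * q)))
        (Rabs_triang (- (S * q)) (- (S * q))).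
      rewrite Rabs_Ropp. lra.
    - apply Htwo; rewrite ?Rabs_Ropp; assumption. }
  set (h11 := bilin g A A) in *. set (h12 := bilin g A B) in *. set (h22 := bilin g B B) in *.
  assert (L11 : jet d th 400 h11 1 (tau + 2 * om * S)) by (eapply jet_h11; eassumption).
  assert (L12 : jet d th 400 h12 0 0) by (eapply jet_h12; eassumption).
  assert (L22 : jet d th 400 h22 1 (tau - 2 * om * S)) by (eapply jet_h22; eassumption).
  (* The determinant is [1 + O(d + th)]; the numerical smallness of [d + eps] is what keeps it away
     from 0 despite the large jet constant. *)
  assert (Hdet : h11 * h22 - h12 * h12 <> 0).
  { assert (J : jet d th 2000000 (h11 * h22 - h12 * h12) 1 (2 * tau)) by jets_by.
    destruct J as (_ & _ & J1 & J3).
    assert (Rabs (h11 * h22 - h12 * h12 - 1) <= 2000000 * (d + th)).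
    { replace (h11 * h22 - h12 * h12 - 1) with
        ((h11 * h22 - h12 * h12 - (1 + 2 * tau)) + 2 * tau) by ring.
      eapply Rle_trans; [apply Rabs_triang | lra]. }
    intros E. rewrite E in H. unfold th in H.
    assert (Rabs (0 - 1) = 1) by (rewrite Rabs_left; lra). lra. }
  specialize (Hmc (gnormal g A B) (bilin_gnormal_l _ _ _) (bilin_gnormal_r _ _ _)).
  cbv zeta in Hmc. fold h11 h12 h22 in Hmc.
  pose proof (jet_acc d th tau g P dg A B Hd1 Ht1 Hdt Jg Jdg S om p q JA JB
    _ _ _ _ _ _ _ _ _ JA JA J11) as Q11.
  pose proof (jet_acc d th tau g P dg A B Hd1 Ht1 Hdt Jg Jdg S om p q JA JB
    _ _ _ _ _ _ _ _ _ JA JB J12) as Q12.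
  pose proof (jet_acc d th tau g P dg A B Hd1 Ht1 Hdt Jg Jdg S om p q JA JB
    _ _ _ _ _ _ _ _ _ JB JA J21) as Q21.
  pose proof (jet_acc d th tau g P dg A B Hd1 Ht1 Hdt Jg Jdg S om p q JA JB
    _ _ _ _ _ _ _ _ _ JB JB J22) as Q22.
  set (a11 := acc_low g dg (gnormal g A B) A A C11) in *.
  set (a12 := acc_low g dg (gnormal g A B) A B C12) in *.
  set (a21 := acc_low g dg (gnormal g A B) B A C21) in *.
  set (a22 := acc_low g dg (gnormal g A B) B B C22) in *.
  assert (E : h22 * a11 - h12 * a12 - h12 * a21 + h11 * a22 = 0).
  { replace (h22 * a11 - h12 * a12 - h12 * a21 + h11 * a22) with
     ((h11 * h22 - h12 * h12) *
      (h22 / (h11 * h22 - h12 * h12) * a11 + - h12 / (h11 * h22 - h12 * h12) * a12 +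
      - h12 / (h11 * h22 - h12 * h12) * a21 + h11 / (h11 * h22 - h12 * h12) * a22))
     by (field; assumption).
    rewrite Hmc. ring. }
  (* The zeroth order [- S + S] vanishes because the catenoid is minimal. At first order the terms
     in [tau], [p], [q] cancel, [h11] and [h22] give [4 * S ^ 2 * om], the accelerations give
     [- 2 * S ^ 2 * om], and each diagonal Christoffel term gives [- P i3 / 2]. *)
  assert (J : jet d th 20000000000000 (h22 * a11 - h12 * a12 - h12 * a21 + h11 * a22) 0
     (uu + vv + 2 * (S * S) * om - P i3)).
  { eapply jet_weaken; [lra | lra | jets | | | lra].
    - cbn; ring.
    - unfold sum3; cbn; field. }
  destruct J as (_ & _ & _ & J). rewrite E in J.
  replace (0 - _) with (- (uu + vv + 2 * (S * S) * om - P i3)) in J by ring.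
  now rewrite Rabs_Ropp in J.
Qed.

(** * The catenoid and its adapted frame *)


Definition tri (dG : idx -> Mat) (X Y Z : R3) : R :=
  sum3 (fun k => sum3 (fun i => sum3 (fun j => dG k i j * X k * Y i * Z j))).

(** Koszul form of the Christoffel term: once it is written with a trilinear form, changing frame is
    mere multilinearity. *)
Lemma acc_low_tri (G : Mat) (dG : idx -> Mat) (X A B C : R3) :
  acc_low G dG X A B C =
  bilin G X C + / 2 * (tri dG A X B + tri dG B X A - tri dG X A B).
Proof. unfold acc_low, bilin, tri, Gam1, sum3. ring. Qed.

Definition comb (E : idx -> R3) (s : R) (y : R3) : R3 :=
  fun k => s * sum3 (fun a => y a * E a k).

Lemma bilin_comb (G : Mat) (E : idx -> R3) (s t : R) (X Y : R3) :
  bilin G (comb E s X) (comb E t Y)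
  = s * t * bilin (fun a b => bilin G (E a) (E b)) X Y.
Proof. unfold bilin, comb, sum3. ring. Qed.

Lemma tri_comb_1 (dG : idx -> Mat) (E : idx -> R3) (s : R) (X Y Z : R3) :
  tri dG (comb E s X) Y Z = s * sum3 (fun a => X a * tri dG (E a) Y Z).
Proof. unfold tri, comb, sum3. ring. Qed.

Lemma tri_comb_2 (dG : idx -> Mat) (E : idx -> R3) (s : R) (X Y Z : R3) :
  tri dG X (comb E s Y) Z = s * sum3 (fun a => Y a * tri dG X (E a) Z).
Proof. unfold tri, comb, sum3. ring. Qed.

Lemma tri_comb_3 (dG : idx -> Mat) (E : idx -> R3) (s : R) (X Y Z : R3) :
  tri dG X Y (comb E s Z) = s * sum3 (fun a => Z a * tri dG X Y (E a)).
Proof. unfold tri, comb, sum3. ring. Qed.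

Lemma tri_comb (dG : idx -> Mat) (E : idx -> R3) (s t r : R) (X Y Z : R3) :
  tri dG (comb E s X) (comb E t Y) (comb E r Z)
  = s * t * r * tri (fun a b c => tri dG (E a) (E b) (E c)) X Y Z.
Proof.
  assert (H : forall D, tri D X Y Z =
    sum3 (fun k => X k * sum3 (fun i => Y i * sum3 (fun j => Z j * D k i j))))
    by (intros; unfold tri, sum3; ring).
  rewrite (H (fun a b c => tri dG (E a) (E b) (E c))).
  rewrite tri_comb_1. unfold sum3. rewrite !tri_comb_2. unfold sum3.
  rewrite !tri_comb_3. unfold sum3. ring.
Qed.

(** The [G] term has degree one in [s] and the [dG] term degree two; the surplus factor is moved
    onto [dG], as a change of unit of length does. *)
Lemma acc_low_comb (G : Mat) (dG : idx -> Mat) (E : idx -> R3) (s : R) (X A B C : R3) :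
  acc_low G dG (comb E 1 X) (comb E s A) (comb E s B) (comb E s C)
  = s * acc_low (fun a b => bilin G (E a) (E b))
                (fun a b c => s * tri dG (E a) (E b) (E c)) X A B C.
Proof.
  rewrite !acc_low_tri, bilin_comb, !tri_comb.
  assert (H : forall D Y Z W, tri (fun a b c => s * D a b c) Y Z W = s * tri D Y Z W)
    by (intros; unfold tri, sum3; ring).
  specialize (H (fun a b c => tri dG (E a) (E b) (E c))). cbv beta in H.
  rewrite !H. ring.
Qed.

(** A normal [X] in frame components is tested through [comb E 1 X], and the remaining powers of [s]
    cancel up to one nonzero factor. *)
Lemma mean_curv_vanishes_comb (G : Mat) (dG : idx -> Mat) (E : idx -> R3) (s : R)
  (A B C11 C12 C21 C22 : R3) :
  s <> 0 ->
  mean_curv_vanishes G dG (comb E s A) (comb E s B)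
    (comb E s C11) (comb E s C12) (comb E s C21) (comb E s C22) ->
  mean_curv_vanishes (fun a b => bilin G (E a) (E b))
    (fun a b c => s * tri dG (E a) (E b) (E c)) A B C11 C12 C21 C22.
Proof.
  intros Hs H X H1 H2.
  specialize (H (comb E 1 X)). cbv zeta in H.
  rewrite !bilin_comb, !acc_low_comb in H.
  set (g := fun a b => bilin G (E a) (E b)) in *.
  rewrite H1, H2 in H.
  specialize (H ltac:(ring) ltac:(ring)).
  replace (s * s * bilin g A A * (s * s * bilin g B B)
           - s * s * bilin g A B * (s * s * bilin g A B))
    with ((s * s * s * s) * (bilin g A A * bilin g B B - bilin g A B * bilin g A B))
    in H by ring.
  unfold Rdiv in *. rewrite Rinv_mult in H.
  (* The inverse determinant stays opaque: [Rinv_mult] has already split off the power of [s], an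
     identity that holds even at a zero determinant. *)
  set (D := / (bilin g A A * bilin g B B - bilin g A B * bilin g A B)) in *.
  apply (Rmult_eq_reg_l (/ s)); [| apply Rinv_neq_0_compat; assumption].
  rewrite Rmult_0_r, <- H at 1.
  field. assumption.
Qed.

(** * Hyperbolic functions and rules of differentiation *)

Definition sech (v : R) : R := / cosh v.

Lemma cosh_ge_1 v : 1 <= cosh v.
Proof.
  unfold cosh. pose proof (exp_ineq1_le v). pose proof (exp_ineq1_le (- v)). lra.
Qed.

Lemma cosh_neq_0 v : cosh v <> 0.
Proof. generalize (cosh_ge_1 v); lra. Qed.

Lemma cosh2_sinh2 v : cosh v * cosh v - sinh v * sinh v = 1.
Proof.
  unfold cosh, sinh.
  replace ((exp v + exp (- v)) / 2 * ((exp v + exp (- v)) / 2)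
    - (exp v - exp (- v)) / 2 * ((exp v - exp (- v)) / 2))
    with (exp v * exp (- v)) by field.
  rewrite <- exp_plus, Rplus_opp_r. apply exp_0.
Qed.

Lemma tanh2_sech2 v : tanh v * tanh v + sech v * sech v = 1.
Proof.
  unfold tanh, sech. pose proof (cosh_neq_0 v). pose proof (cosh2_sinh2 v).
  replace (sinh v / cosh v * (sinh v / cosh v) + / cosh v * / cosh v)
    with ((sinh v * sinh v + 1) / (cosh v * cosh v)) by (field; assumption).
  replace (sinh v * sinh v + 1) with (cosh v * cosh v) by lra.
  field. assumption.
Qed.

Lemma sech_bounds v : 0 < sech v <= 1.
Proof.
  unfold sech. pose proof (cosh_ge_1 v). split.
  - apply Rinv_0_lt_compat. lra.
  - rewrite <- Rinv_1. apply Rinv_le_contravar; lra.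
Qed.

Lemma tanh_abs_le_1 v : Rabs (tanh v) <= 1.
Proof. pose proof (tanh2_sech2 v). apply Rabs_le. nra. Qed.

Lemma derivable_pt_lim_eq f x l l' : derivable_pt_lim f x l -> l = l' -> derivable_pt_lim f x l'.
Proof. now intros H <-. Qed.

Lemma derivable_pt_lim_tanh v : derivable_pt_lim tanh v (sech v * sech v).
Proof.
  eapply derivable_pt_lim_eq.
  - apply (derivable_pt_lim_div sinh cosh v).
    + apply derivable_pt_lim_sinh.
    + apply derivable_pt_lim_cosh.
    + apply cosh_neq_0.
  - unfold sech, Rsqr. rewrite <- Rinv_mult.
    rewrite cosh2_sinh2. unfold Rdiv; ring.
Qed.

Lemma derivable_pt_lim_sech v : derivable_pt_lim sech v (- (sech v * tanh v)).
Proof.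
  apply (derivable_pt_lim_ext (fct_cte 1 / cosh)%F).
  { intros z. unfold div_fct, fct_cte, sech. unfold Rdiv. ring. }
  eapply derivable_pt_lim_eq.
  - apply (derivable_pt_lim_div (fct_cte 1) cosh v).
    + apply derivable_pt_lim_const.
    + apply derivable_pt_lim_cosh.
    + apply cosh_neq_0.
  - unfold sech, tanh, Rsqr, fct_cte. pose proof (cosh_neq_0 v). field. assumption.
Qed.

Lemma derive_plus f g x f' g' :
  derivable_pt_lim f x f' -> derivable_pt_lim g x g' ->
  derivable_pt_lim (fun t => f t + g t) x (f' + g').
Proof. apply derivable_pt_lim_plus. Qed.

Lemma derive_minus f g x f' g' :
  derivable_pt_lim f x f' -> derivable_pt_lim g x g' ->
  derivable_pt_lim (fun t => f t - g t) x (f' - g').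
Proof. apply derivable_pt_lim_minus. Qed.

Lemma derive_opp f x f' :
  derivable_pt_lim f x f' -> derivable_pt_lim (fun t => - f t) x (- f').
Proof. apply derivable_pt_lim_opp. Qed.

Lemma derive_mult f g x f' g' :
  derivable_pt_lim f x f' -> derivable_pt_lim g x g' ->
  derivable_pt_lim (fun t => f t * g t) x (f' * g x + f x * g').
Proof. apply derivable_pt_lim_mult. Qed.

Lemma derive_const (a x : R) : derivable_pt_lim (fun _ => a) x 0.
Proof. apply derivable_pt_lim_const. Qed.

Lemma derive_id (x : R) : derivable_pt_lim (fun t => t) x 1.
Proof. apply derivable_pt_lim_id. Qed.

Ltac derive := repeat first
  [ eassumption
  | apply derive_const
  | apply derive_id
  | apply derivable_pt_lim_sin
  | apply derivable_pt_lim_cos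
  | apply derivable_pt_lim_sinh
  | apply derivable_pt_lim_cosh
  | apply derivable_pt_lim_tanh
  | apply derivable_pt_lim_sech
  | match goal with
    | |- derivable_pt_lim (Rmult ?a) _ _ =>
        apply (derive_mult (fun _ => a) (fun t => t))
    | |- derivable_pt_lim (fun t => _ + _) _ _ => eapply derive_plus
    | |- derivable_pt_lim (fun t => _ - _) _ _ => eapply derive_minus
    | |- derivable_pt_lim (fun t => - _) _ _ => eapply derive_opp
    | |- derivable_pt_lim (fun t => _ * _) _ _ => eapply derive_mult
    end ].

(** Unit tangents in the directions [u] and [v], then the unit normal; the same for every neck
    size. *)
Definition cat_frame (u v : R) (a : idx) : R3 :=
  match a with
  | i1 => triple (- sin u) (cos u) 0
  | i2 => triple (tanh v * cos u) (tanh v * sin u) (sech v)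
  | i3 => triple (sech v * cos u) (sech v * sin u) (- tanh v)
  end.

Lemma cat_frame_orthonormal u v a b :
  sum3 (fun k => cat_frame u v a k * cat_frame u v b k) = kron a b.
Proof.
  pose proof (sin2_cos2 u) as H. unfold Rsqr in H.
  pose proof (tanh2_sech2 v) as H'.
  set (x := sin u) in *. set (y := cos u) in *.
  set (T := tanh v) in *. set (S := sech v) in *.
  assert (Hy : y * y = 1 - x * x) by lra. assert (HS : S * S = 1 - T * T) by lra.
  destruct a, b; unfold sum3, kron; cbn; fold x y T S; ring [Hy HS].
Qed.

Lemma cat_frame_le_1 u v a k : Rabs (cat_frame u v a k) <= 1.
Proof.
  pose proof (cat_frame_orthonormal u v a a) as H.
  replace (kron a a) with 1 in H by (destruct a; reflexivity).
  unfold sum3 in H. apply Rabs_le. destruct k; nra.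
Qed.

(** Structure equations. The normal turns by [sech v] along [i1] here and by [- sech v] along [i2]
    in [derive_frame_v]; up to the scale [c * cosh v] these are the principal curvatures, opposite
    by minimality. *)
Lemma derive_frame_u u v a k :
  derivable_pt_lim (fun t => cat_frame t v a k) u
    (match a with
     | i1 => - (tanh v * cat_frame u v i2 k + sech v * cat_frame u v i3 k)
     | i2 => tanh v * cat_frame u v i1 k
     | i3 => sech v * cat_frame u v i1 k
     end).
Proof.
  pose proof (tanh2_sech2 v) as H'.
  assert (HS : sech v * sech v = 1 - tanh v * tanh v) by lra.
  destruct a, k; cbn; (eapply derivable_pt_lim_eq; [derive | cbv beta; ring [HS]]).
Qed.

Lemma derive_frame_v u v a k :
  derivable_pt_lim (fun t => cat_frame u t a k) v
    (match a with
     | i1 => 0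
     | i2 => sech v * cat_frame u v i3 k
     | i3 => - (sech v * cat_frame u v i2 k)
     end).
Proof.
  destruct a, k; cbn; (eapply derivable_pt_lim_eq; [derive | cbv beta; ring]).
Qed.

(** * Derivatives of the normal graph in frame components *)

Section Graph.
Variables (c : R) (Om : R -> R -> R) (DOm : list bool -> R -> R -> R).
Hypothesis Hc : 0 < c.
Hypothesis HDnil : forall u v, DOm nil u v = Om u v.
Hypothesis HD : forall a d u v, (length a <= 1)%nat ->
  partial2 (DOm a) d u v (DOm (d :: a) u v).

Let Ou := DOm (false :: nil).
Let Ov := DOm (true :: nil).

Lemma catenoid_graph_frame u v k :
  catenoid_graph c Om u v k =
  c * cosh v * triple (cos u) (sin u) 0 k + c * v * triple 0 0 1 k
  + DOm nil u v * cat_frame u v i3 k.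
Proof.
  rewrite HDnil. destruct k; cbn; unfold sech, Rdiv; ring.
Qed.

Lemma partial_u a u v : (length a <= 1)%nat ->
  derivable_pt_lim (fun t => DOm a t v) u (DOm (false :: a) u v).
Proof. exact (HD a false u v). Qed.

Lemma partial_v a u v : (length a <= 1)%nat ->
  derivable_pt_lim (fun t => DOm a u t) v (DOm (true :: a) u v).
Proof. exact (HD a true u v). Qed.

Lemma graph_u u v k :
  derivable_pt_lim (fun t => catenoid_graph c Om t v k) u
    ((c * cosh v + DOm nil u v * sech v) * cat_frame u v i1 k + Ou u v * cat_frame u v i3 k).
Proof.
  eapply derivable_pt_lim_ext.
  { intros z. symmetry. apply catenoid_graph_frame. }
  pose proof (partial_u nil u v ltac:(cbn; lia)).
  pose proof (derive_frame_u u v i3 k).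
  assert (derivable_pt_lim (fun t => triple (cos t) (sin t) 0 k) u (cat_frame u v i1 k))
    by (destruct k; cbn; derive).
  eapply derivable_pt_lim_eq; [derive |]. cbv beta. unfold Ou. ring.
Qed.

Lemma graph_v u v k :
  derivable_pt_lim (fun t => catenoid_graph c Om u t k) v
    ((c * cosh v - DOm nil u v * sech v) * cat_frame u v i2 k + Ov u v * cat_frame u v i3 k).
Proof.
  eapply derivable_pt_lim_ext.
  { intros z. symmetry. apply catenoid_graph_frame. }
  pose proof (partial_v nil u v ltac:(cbn; lia)).
  pose proof (derive_frame_v u v i3 k).
  eapply derivable_pt_lim_eq; [derive |]. cbv beta. unfold Ov.
  pose proof (cosh_neq_0 v).
  destruct k; cbn; unfold sech, tanh; field; assumption.
Qed.

(** Both first derivatives of the graph combine one unit tangent ([a]) and the normal, so this rule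
    and its counterpart in [v] yield all second derivatives. *)
Lemma derive_coef_u u v k (f g : R -> R) f' g' a :
  derivable_pt_lim f u f' -> derivable_pt_lim g u g' ->
  derivable_pt_lim (fun t => f t * cat_frame t v a k + g t * cat_frame t v i3 k) u
    (f' * cat_frame u v a k + g' * cat_frame u v i3 k + g u * (sech v * cat_frame u v i1 k)
     + f u * (match a with
     | i1 => - (tanh v * cat_frame u v i2 k + sech v * cat_frame u v i3 k)
     | i2 => tanh v * cat_frame u v i1 k
     | i3 => sech v * cat_frame u v i1 k
     end)).
Proof.
  intros. pose proof (derive_frame_u u v i3 k). pose proof (derive_frame_u u v a k).
  eapply derivable_pt_lim_eq; [derive |]. cbv beta. ring.
Qed.

Lemma derive_coef_v u v k (f g : R -> R) f' g' a :
  derivable_pt_lim f v f' -> derivable_pt_lim g v g' ->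
  derivable_pt_lim (fun t => f t * cat_frame u t a k + g t * cat_frame u t i3 k) v
    (f' * cat_frame u v a k + g' * cat_frame u v i3 k + g v * (- (sech v * cat_frame u v i2 k))
     + f v * (match a with
     | i1 => 0
     | i2 => sech v * cat_frame u v i3 k
     | i3 => - (sech v * cat_frame u v i2 k)
     end)).
Proof.
  intros. pose proof (derive_frame_v u v i3 k). pose proof (derive_frame_v u v a k).
  eapply derivable_pt_lim_eq; [derive |]. cbv beta. ring.
Qed.

Variable DF : list bool -> R -> R -> R3.
Hypothesis HFnil : forall u v, DF nil u v = catenoid_graph c Om u v.
Hypothesis HF : forall a d u v k, (length a <= 1)%nat ->
  partial2 (fun s t => DF a s t k) d u v (DF (d :: a) u v k).

(** The derivatives carried by a minimal immersion are existential data; uniqueness of limits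
    identifies them with the computed ones. *)
Lemma DF_u u v k : DF (false :: nil) u v k =
  (c * cosh v + DOm nil u v * sech v) * cat_frame u v i1 k + Ou u v * cat_frame u v i3 k.
Proof.
  eapply uniqueness_limite; [exact (HF nil false u v k ltac:(cbn; lia)) |].
  eapply derivable_pt_lim_ext; [| apply graph_u].
  intros z. cbv beta. now rewrite HFnil.
Qed.

Lemma DF_v u v k : DF (true :: nil) u v k =
  (c * cosh v - DOm nil u v * sech v) * cat_frame u v i2 k + Ov u v * cat_frame u v i3 k.
Proof.
  eapply uniqueness_limite; [exact (HF nil true u v k ltac:(cbn; lia)) |].
  eapply derivable_pt_lim_ext; [| apply graph_v].
  intros z. cbv beta. now rewrite HFnil.
Qed.

Section Coordinates.
Variables u v : R.
Let s := c * cosh v.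
Let om := DOm nil u v / s.
Let p := Ou u v / s.
Let q := Ov u v / s.

Lemma s_neq_0 : s <> 0.
Proof. apply Rmult_integral_contrapositive. generalize (cosh_neq_0 v). split; lra. Qed.

(** [s] is the length of both coordinate tangent vectors of the catenoid, so factoring it out leaves
    a basis vector plus terms of the size of [Om / s] and its analogues. *)
Lemma DF_u_comb : DF (false :: nil) u v
  = comb (cat_frame u v) s (triple (1 + om * sech v) 0 p).
Proof.
  apply functional_extensionality; intros k. rewrite DF_u. pose proof s_neq_0.
  unfold comb, sum3, om, p. cbn -[cat_frame]. fold s. field. assumption.
Qed.

Lemma DF_v_comb : DF (true :: nil) u v
  = comb (cat_frame u v) s (triple 0 (1 - om * sech v) q).
Proof.
  apply functional_extensionality; intros k. rewrite DF_v. pose proof s_neq_0.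
  unfold comb, sum3, om, q. cbn -[cat_frame]. fold s. field. assumption.
Qed.

Ltac second_partial a d lem coef :=
  apply functional_extensionality; intros k; pose proof s_neq_0;
  pose proof (partial_u nil u v ltac:(cbn; lia));
  pose proof (partial_v nil u v ltac:(cbn; lia));
  pose proof (partial_u (false :: nil) u v ltac:(cbn; lia));
  pose proof (partial_v (false :: nil) u v ltac:(cbn; lia));
  pose proof (partial_u (true :: nil) u v ltac:(cbn; lia));
  pose proof (partial_v (true :: nil) u v ltac:(cbn; lia));
  eapply uniqueness_limite; [exact (HF (a :: nil) d u v k ltac:(cbn; lia)) |];
  eapply derivable_pt_lim_ext; [intros z; symmetry; apply lem |];
  eapply derivable_pt_lim_eq; [apply coef; unfold Ou, Ov; derive |];
  cbv beta; unfold comb, sum3, om, p, q, Ou, Ov; cbn -[cat_frame cosh].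

Lemma DF_uu_comb : DF (false :: false :: nil) u v
  = comb (cat_frame u v) s (triple (2 * sech v * p) (- tanh v * (1 + om * sech v))
      (DOm (false :: false :: nil) u v / s - sech v * (1 + om * sech v))).
Proof. second_partial false false DF_u derive_coef_u. fold s. field. assumption. Qed.

Lemma DF_uv_comb : DF (false :: true :: nil) u v
  = comb (cat_frame u v) s (triple (tanh v * (1 - om * sech v) + sech v * q)
      (- sech v * p) (DOm (false :: true :: nil) u v / s)).
Proof. second_partial true false DF_v derive_coef_u. fold s. field. assumption. Qed.

(** The left side is the [v]-derivative of [s], which appears once a first derivative is
    differentiated in [v]. *)
Lemma sinh_tanh : c * sinh v = s * tanh v.
Proof. unfold s, tanh. field. apply cosh_neq_0. Qed.

Lemma DF_vu_comb : DF (true :: false :: nil) u v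
  = comb (cat_frame u v) s (triple (tanh v * (1 - om * sech v) + sech v * q)
      (- sech v * p) (DOm (true :: false :: nil) u v / s)).
Proof.
  second_partial false true DF_u derive_coef_v. pose proof sinh_tanh as E. fold s.
  rewrite E. field. assumption.
Qed.

Lemma DF_vv_comb : DF (true :: true :: nil) u v
  = comb (cat_frame u v) s (triple 0 (tanh v * (1 + om * sech v) - 2 * sech v * q)
      (DOm (true :: true :: nil) u v / s + sech v * (1 - om * sech v))).
Proof.
  second_partial true true DF_v derive_coef_v. pose proof sinh_tanh as E. fold s.
  rewrite E. field. assumption.
Qed.
End Coordinates.
End Graph.

(** * The metric *)


Lemma limit1_in_ext f g (D : R -> Prop) l x0 :
  (forall h, D h -> f h = g h) -> limit1_in f D l x0 -> limit1_in g D l x0.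
Proof.
  intros E H eps Heps. destruct (H eps Heps) as (a & Ha & Hl).
  exists a; split; [assumption |]. intros h Hh. rewrite <- E by tauto. now apply Hl.
Qed.

Lemma norm3_sqr x : norm3 x * norm3 x = sum3 (fun k => x k ^ 2).
Proof. apply sqrt_sqrt. unfold sum3. nra. Qed.

Lemma norm3_pos x : 0 <= norm3 x.
Proof. apply sqrt_pos. Qed.

Lemma Rabs_le_norm3 x k : Rabs (x k) <= norm3 x.
Proof.
  pose proof (norm3_sqr x) as H. pose proof (norm3_pos x). unfold sum3 in H.
  apply Rabs_le. destruct k; nra.
Qed.

Lemma sum3_shift x k h :
  sum3 (fun j => shift x k h j ^ 2) = sum3 (fun j => x j ^ 2) + 2 * x k * h + h * h.
Proof. unfold sum3, shift. destruct k; cbn; ring. Qed.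

Lemma shift_0 x k : shift x k 0 = x.
Proof.
  apply functional_extensionality; intros j. unfold shift.
  destruct (idx_eqb j k); ring.
Qed.

(** A step with the sign of [x k] does not decrease the norm, so admissible increments accumulate at
    0 even on the boundary sphere; partial derivatives within [Mdom r0] are therefore unique. *)
Lemma Mdom_adherent r0 x k :
  Mdom r0 x -> adhDa (fun h => h <> 0 /\ Mdom r0 (shift x k h)) 0.
Proof.
  intros Hx al Hal.
  assert (H : exists h, h <> 0 /\ Rabs h < al /\ 0 <= x k * h).
  { destruct (Rle_dec 0 (x k)).
    - exists (al / 2). rewrite Rabs_pos_eq by lra. repeat split; try lra. nra.
    - exists (- (al / 2)). rewrite Rabs_Ropp, Rabs_pos_eq by lra.
      repeat split; try lra. nra. }
  destruct H as (h & Hh & Ha & Hp). exists h. split; [split; [assumption |] |].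
  - eapply Rle_trans; [exact Hx |]. unfold norm3. apply sqrt_le_1_alt.
    rewrite sum3_shift. nra.
  - unfold Rdist. now rewrite Rminus_0_r.
Qed.

Lemma partial_within_unique r0 f k x l l' : Mdom r0 x ->
  partial_within (Mdom r0) f k x l -> partial_within (Mdom r0) f k x l' -> l = l'.
Proof.
  intros Hx H H'. eapply single_limit; [| exact H | exact H'].
  now apply Mdom_adherent.
Qed.

(** Gradient of the Schwarzschild factor [(1 + m / (2 * norm3 x)) ^ 4]; it is radial. *)
Definition conf_grad (m : R) (x : R3) (k : idx) : R :=
  - 2 * m * (1 + m / (2 * norm3 x)) ^ 3 * x k / norm3 x ^ 3.

Lemma derive_conf m x k w : 0 < norm3 x ->
  derivable_pt_lim (fun h => (1 + m / (2 * norm3 (shift x k h))) ^ 4 * w) 0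
    (conf_grad m x k * w).
Proof.
  intros Hx. pose proof (norm3_sqr x) as Hs.
  apply is_derive_Reals.
  apply (is_derive_ext (fun h =>
     (1 + m / (2 * sqrt (sum3 (fun j => x j ^ 2) + 2 * x k * h + h * h))) ^ 4 * w)).
  { intros h. unfold norm3. now rewrite sum3_shift. }
  set (Q := sum3 (fun j => x j ^ 2)) in *.
  assert (HQ : 0 < Q) by (rewrite <- Hs; nra).
  assert (Eq : Q + 2 * x k * 0 + 0 * 0 = Q) by ring.
  assert (HsQ : sqrt Q = norm3 x) by reflexivity.
  auto_derive.
  - rewrite Eq. rewrite HsQ. repeat split; lra.
  - rewrite Eq, HsQ. unfold conf_grad. field. lra.
Qed.

Lemma partial_within_derive (D : R3 -> Prop) f k x l :
  derivable_pt_lim (fun h => f (shift x k h)) 0 l -> partial_within D f k x l.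
Proof.
  intros H eps Heps. destruct (H eps Heps) as (d & Hd).
  exists d. split; [apply cond_pos |]. intros h [[Hh _] Hh'].
  unfold dist, Base, R_met, Rdist in *. rewrite Rminus_0_r in Hh'.
  specialize (Hd h Hh Hh'). rewrite Rplus_0_l, shift_0 in Hd. exact Hd.
Qed.

Lemma metric_partial r0 m e De x k i j dG :
  0 < r0 -> Mdom r0 x ->
  (forall y, Mdom r0 y -> De nil y i j = e y i j) ->
  partial_within (Mdom r0) (fun y => De nil y i j) k x (De (k :: nil) x i j) ->
  partial_within (Mdom r0) (fun y => metric m e y i j) k x dG ->
  dG = conf_grad m x k * kron i j + De (k :: nil) x i j.
Proof.
  intros Hr Hx H0 HDe HdG.
  eapply partial_within_unique; [exact Hx | exact HdG |].
  assert (Hc : partial_within (Mdom r0)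
     (fun y => (1 + m / (2 * norm3 y)) ^ 4 * kron i j) k x (conf_grad m x k * kron i j)).
  { apply partial_within_derive, derive_conf. unfold Mdom in Hx. lra. }
  eapply limit1_in_ext; [| exact (limit_plus _ _ _ _ _ _ Hc HDe)].
  intros h [Hh Hd]. unfold metric. cbv beta. rewrite (H0 x Hx), (H0 _ Hd). unfold Rdiv. ring.
Qed.

Lemma sum3_bound f b : (forall i, Rabs (f i) <= b) -> Rabs (sum3 f) <= 3 * b.
Proof.
  intros H. unfold sum3. generalize (H i1) (H i2) (H i3)
    (Rabs_triang (f i1 + f i2) (f i3)) (Rabs_triang (f i1) (f i2)). lra.
Qed.

Lemma Rabs_mult_le_1 x y b : Rabs x <= b -> Rabs y <= 1 -> Rabs (x * y) <= b.
Proof. intros. replace b with (b * 1) by ring. now apply Rabs_mult_le. Qed.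

Lemma bilin_bound G X Y b : (forall i j, Rabs (G i j) <= b) ->
  (forall i, Rabs (X i) <= 1) -> (forall i, Rabs (Y i) <= 1) ->
  Rabs (bilin G X Y) <= 9 * b.
Proof.
  intros HG HX HY. replace (9 * b) with (3 * (3 * b)) by ring.
  unfold bilin. repeat (apply sum3_bound; intro).
  repeat apply Rabs_mult_le_1; auto.
Qed.

Lemma tri_bound dG X Y Z b : (forall k i j, Rabs (dG k i j) <= b) ->
  (forall i, Rabs (X i) <= 1) -> (forall i, Rabs (Y i) <= 1) -> (forall i, Rabs (Z i) <= 1) ->
  Rabs (tri dG X Y Z) <= 27 * b.
Proof.
  intros HG HX HY HZ. replace (27 * b) with (3 * (3 * (3 * b))) by ring.
  unfold tri. repeat (apply sum3_bound; intro).
  repeat apply Rabs_mult_le_1; auto.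
Qed.

Lemma bilin_conformal w (M : Mat) X Y :
  bilin (fun i j => w * kron i j + M i j) X Y
  = w * sum3 (fun k => X k * Y k) + bilin M X Y.
Proof. unfold bilin, sum3, kron; cbn. ring. Qed.

Lemma tri_conformal (W : R3) (M : idx -> Mat) X Y Z :
  tri (fun k i j => W k * kron i j + M k i j) X Y Z
  = sum3 (fun k => W k * X k) * sum3 (fun k => Y k * Z k) + tri M X Y Z.
Proof. unfold tri, sum3, kron; cbn. ring. Qed.

(* Normal component of the position vector of the catenoid with [c = 1]; it solves
   [f'' + 2 sech^2 f = 0]. *)
Definition dilation_jacobi (v : R) : R := 1 - v * tanh v.

(** Paired with the normal, the radial [conf_grad] becomes a multiple of this quantity, so testing
    with [dilation_jacobi] produces a square up to a term in [Om]. *)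
Lemma graph_dot_normal c Om u v :
  sum3 (fun k => catenoid_graph c Om u v k * cat_frame u v i3 k)
  = c * dilation_jacobi v + Om u v.
Proof.
  pose proof (sin2_cos2 u) as H. unfold Rsqr in H.
  pose proof (tanh2_sech2 v) as H'.
  assert (Hy : cos u * cos u = 1 - sin u * sin u) by lra.
  assert (HS : sech v * sech v = 1 - tanh v * tanh v) by lra.
  assert (HC : sech v * cosh v = 1) by (apply Rinv_l, cosh_neq_0).
  unfold sum3, dilation_jacobi. cbn -[cosh tanh]. unfold Rdiv.
  fold (sech v). ring [Hy HS HC].
Qed.

Lemma graph_norm_sqr c Om u v :
  norm3 (catenoid_graph c Om u v) * norm3 (catenoid_graph c Om u v)
  = (c * cosh v + Om u v * sech v) * (c * cosh v + Om u v * sech v)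
    + (c * v - tanh v * Om u v) * (c * v - tanh v * Om u v).
Proof.
  rewrite norm3_sqr.
  pose proof (sin2_cos2 u) as H. unfold Rsqr in H.
  assert (Hy : cos u * cos u = 1 - sin u * sin u) by lra.
  unfold sum3. cbn -[cosh tanh]. unfold Rdiv. fold (sech v). ring [Hy].
Qed.

(** * Pointwise estimate *)


Lemma Rle_div_of_mul a b c : 0 < c -> a * c <= b -> a <= b / c.
Proof.
  intros Hc H. apply (Rmult_le_reg_r c); [assumption |].
  unfold Rdiv. rewrite Rmult_assoc, Rinv_l by lra. lra.
Qed.

Lemma Rabs_div_le a b s : 0 < s -> Rabs a <= b -> Rabs (a / s) <= b / s.
Proof.
  intros Hs H. unfold Rdiv. rewrite Rabs_mult, (Rabs_pos_eq (/ s)).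
  - apply Rmult_le_compat_r; [| assumption]. left. now apply Rinv_0_lt_compat.
  - left. now apply Rinv_0_lt_compat.
Qed.

Lemma Rdiv_le_compat_l b r r' : 0 <= b -> 0 < r -> r <= r' -> b / r' <= b / r.
Proof.
  intros. unfold Rdiv. apply Rmult_le_compat_l; [assumption |].
  apply Rinv_le_contravar; assumption.
Qed.

Lemma cosh_half_le_2 v : 0 <= v <= / 2 -> cosh v <= 2.
Proof.
  intros Hv. unfold cosh.
  assert (H2 : exp (/ 2) <= 2).
  { pose proof exp_le_3 as H3. replace 1 with (/ 2 + / 2) in H3 by field.
    rewrite exp_plus in H3. pose proof (exp_pos (/ 2)). nra. }
  assert (Hmono : forall y, y <= / 2 -> exp y <= exp (/ 2)).
  { intros y [Hy | ->]; [left; now apply exp_increasing | lra]. }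
  pose proof (Hmono v ltac:(lra)). pose proof (Hmono (- v) ltac:(lra)). lra.
Qed.

(** Since [exp t = exp (t / 4) ^ 4]. Quartic growth beats the cubic product of the linear test
    function and [1 + v ^ 2]. *)
Lemma cosh_quartic t : 0 <= t -> (1 + t / 4) ^ 4 <= 2 * cosh t.
Proof.
  intros Ht. unfold cosh. pose proof (exp_pos (- t)).
  assert (E : exp t = exp (t / 4) ^ 4).
  { simpl. rewrite Rmult_1_r, <- !exp_plus. f_equal. field. }
  assert ((1 + t / 4) ^ 4 <= exp (t / 4) ^ 4).
  { apply pow_incr. pose proof (exp_ineq1_le (t / 4)). lra. }
  lra.
Qed.

Lemma cosh_Rabs v : cosh (Rabs v) = cosh v.
Proof.
  unfold Rabs. destruct (Rcase_abs v); [| reflexivity].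
  unfold cosh. rewrite Ropp_involutive. lra.
Qed.

(** The majorant is chosen for its explicit bounded primitive [atan]. Here 128 is 64, from comparing
    the cubic with the quartic, times the 2 of [cosh_quartic]. *)
Lemma jacobi_sech_bound v : Rabs (dilation_jacobi v) * sech v <= 128 / (1 + v ^ 2).
Proof.
  pose proof (Rabs_pos v) as Ht. pose proof (cosh_quartic _ Ht) as H.
  rewrite cosh_Rabs in H. pose proof (cosh_ge_1 v).
  assert (Hj : Rabs (dilation_jacobi v) <= 1 + Rabs v).
  { unfold dilation_jacobi. eapply Rle_trans; [apply Rabs_triang |].
    rewrite Rabs_R1, Rabs_Ropp. apply Rplus_le_compat_l.
    apply Rabs_mult_le_1; [lra | apply tanh_abs_le_1]. }
  assert (Hv : v ^ 2 = Rabs v ^ 2) by (now rewrite pow2_abs).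
  rewrite Hv. set (t := Rabs v) in *.
  assert ((1 + t) * (1 + t ^ 2) <= 64 * (1 + t / 4) ^ 4).
  { simpl. nra. }
  apply Rle_trans with ((1 + t) * sech v).
  - apply Rmult_le_compat_r; [left; apply sech_bounds | assumption].
  - apply Rle_div_of_mul; [nra |]. unfold sech.
    apply (Rmult_le_reg_r (cosh v)); [lra |].
    replace ((1 + t) * / cosh v * (1 + t ^ 2) * cosh v) with ((1 + t) * (1 + t ^ 2))
      by (field; lra).
    lra.
Qed.

(** Collects the errors of second order in [m]: the [Om] part of the normal component, with
    [128 = 2 * 8 * 8], and the [d * d] part of [mean_curv_expansion]. *)
Definition jacobi_const (KO : R) : R := 128 * KO + 20000000000000 * (KO + 192) ^ 2.

Section Pointwise.
Variables (r0 m K KO c : R) (e : R3 -> Mat) (De : list idx -> R3 -> Mat).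
Variables (Om : R -> R -> R) (DOm : list bool -> R -> R -> R).
Hypothesis Hr0 : 0 < r0.
Hypothesis Hm : 0 < m.
Hypothesis HK : 0 <= K.
Hypothesis HKO : 0 <= KO.
Hypothesis Hc : 1 <= c.
Hypothesis He : forall i j, C2_within (Mdom r0) (fun x => e x i j) (fun a x => De a x i j).
Hypothesis He0 : forall x i j, Mdom r0 x -> Rabs (e x i j) * norm3 x ^ 2 <= K * m.
Hypothesis He1 : forall x k i j, Mdom r0 x ->
  Rabs (De (k :: nil) x i j) * norm3 x ^ 3 <= K * m.
Hypothesis HOm : Cb2 Om DOm.
Hypothesis HOmb : forall a u v, (length a <= 2)%nat -> Rabs (DOm a u v) <= KO * m.
Hypothesis Hsmall : (KO + 192) * m + 216 * K * m <= / 100000000.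
Hypothesis Hmin : minimal_immersion r0 (metric m e) (catenoid_graph c Om).

Section Point.
Variables u v : R.
Let s := c * cosh v.
Let x := catenoid_graph c Om u v.
Let r := norm3 x.
Let phi := 1 + m / (2 * r).

Lemma KOm_nonneg : 0 <= KO * m.
Proof. apply Rmult_le_pos; lra. Qed.

Lemma Km_nonneg : 0 <= K * m.
Proof. apply Rmult_le_pos; lra. Qed.

Lemma smallness : KO * m <= / 2 /\ m <= / 2.
Proof. pose proof KOm_nonneg. pose proof Km_nonneg. lra. Qed.

Lemma s_ge_1 : 1 <= s.
Proof. unfold s. pose proof (cosh_ge_1 v). nra. Qed.

Lemma Om_bound : Rabs (Om u v) <= KO * m.
Proof.
  destruct HOm as (_ & H & _). rewrite <- H. apply HOmb. cbn; lia.
Qed.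

Lemma Om_sech_bound : Rabs (Om u v * sech v) <= / 2.
Proof.
  pose proof smallness. pose proof Om_bound. pose proof (sech_bounds v).
  apply Rle_trans with (KO * m); [| lra].
  apply Rabs_mult_le_1; [assumption |]. rewrite Rabs_pos_eq; lra.
Qed.

(** The horizontal radius is enough, since [Om] changes it by at most [/ 2 <= s / 2]. Negative
    powers of [r] are thereby traded for those of [s]. *)
Lemma r_lower : s / 2 <= r.
Proof.
  pose proof (graph_norm_sqr c Om u v) as H. fold x r s in H.
  pose proof Om_sech_bound as HO. apply Rabs_le_between in HO.
  pose proof s_ge_1. pose proof (norm3_pos x) as Hr. fold r in Hr.
  assert (0 <= s / 2 <= s + Om u v * sech v) by lra.
  pose proof (Rle_0_sqr (c * v - tanh v * Om u v)) as Hq. unfold Rsqr in Hq.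
  set (a := s + Om u v * sech v) in *.
  assert (s / 2 * (s / 2) <= a * a) by (apply Rmult_le_compat; lra).
  apply Rsqr_incr_0_var; unfold Rsqr; lra.
Qed.

Lemma r_upper : 0 <= v <= / 2 -> r <= 2 * s.
Proof.
  intros Hv.
  pose proof (graph_norm_sqr c Om u v) as H. fold x r s in H.
  pose proof Om_sech_bound as HO. apply Rabs_le_between in HO.
  pose proof s_ge_1. pose proof (norm3_pos x) as Hr. fold r in Hr.
  assert (Hcs : c <= s) by (unfold s; pose proof (cosh_ge_1 v); nra).
  assert (HT : Rabs (Om u v * tanh v) <= / 2).
  { pose proof smallness. pose proof Om_bound.
    apply Rle_trans with (KO * m); [| lra].
    apply Rabs_mult_le_1; [assumption |]. apply tanh_abs_le_1. }
  apply Rabs_le_between in HT.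
  assert (0 <= c * v <= / 2 * s) by nra.
  assert (0 <= s + Om u v * sech v <= 3 / 2 * s) by lra.
  assert (- s <= c * v - tanh v * Om u v <= s) by lra.
  set (a := s + Om u v * sech v) in *. set (b := c * v - tanh v * Om u v) in *.
  assert (a * a <= (3 / 2 * s) * (3 / 2 * s)) by (apply Rmult_le_compat; lra).
  assert (b * b <= s * s) by nra.
  apply Rsqr_incr_0_var; unfold Rsqr; nra.
Qed.

Lemma r_pos : 0 < r.
Proof. pose proof r_lower. pose proof s_ge_1. lra. Qed.

Lemma conf_small : 0 <= m / (2 * r) <= m / s.
Proof.
  pose proof r_lower. pose proof s_ge_1. pose proof r_pos. split.
  - apply Rlt_le, Rdiv_lt_0_compat; lra.
  - apply Rdiv_le_compat_l; lra.
Qed.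

Lemma m_div_s : 0 <= m / s <= / 2.
Proof.
  pose proof s_ge_1. pose proof smallness. split.
  - apply Rlt_le, Rdiv_lt_0_compat; lra.
  - apply Rle_trans with (m / 1); [| lra]. apply Rdiv_le_compat_l; lra.
Qed.

Lemma phi_bounds : 1 <= phi <= 2.
Proof. pose proof conf_small. pose proof m_div_s. unfold phi. lra. Qed.

Lemma phi3_bounds : 1 <= phi ^ 3 <= 8.
Proof.
  pose proof phi_bounds. split.
  - replace 1 with (1 ^ 3) by ring. apply pow_incr. lra.
  - replace 8 with (2 ^ 3) by ring. apply pow_incr. lra.
Qed.

Lemma inv_r_pow n : / r ^ n <= 2 ^ n / s ^ n.
Proof.
  pose proof r_lower. pose proof s_ge_1. pose proof r_pos.
  replace (2 ^ n / s ^ n) with (/ (s / 2) ^ n).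
  - apply Rinv_le_contravar; [apply pow_lt; lra | apply pow_incr; lra].
  - unfold Rdiv. rewrite Rpow_mult_distr, pow_inv, Rinv_mult, Rinv_inv. ring.
Qed.

Lemma tau_bound : Rabs (phi ^ 4 - 1) <= (KO + 192) * m / s.
Proof.
  pose proof conf_small as H. pose proof m_div_s.
  assert (E : phi ^ 4 - 1 = m / (2 * r) * (4 + 6 * (m / (2 * r)) + 4 * (m / (2 * r)) ^ 2 + (m / (2 * r)) ^ 3))
    by (unfold phi; ring).
  set (z := m / (2 * r)) in *.
  assert (0 <= z * z <= 1) by nra. assert (0 <= z * z * z <= 1) by nra.
  assert (0 <= KO * (m / s)) by (apply Rmult_le_pos; lra).
  rewrite E, Rabs_pos_eq; [| apply Rmult_le_pos; [lra | nra]].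
  replace ((KO + 192) * m / s) with (KO * (m / s) + 192 * (m / s)) by (unfold Rdiv; ring).
  (* 15 is [4 + 6 + 4 + 1], the binomial coefficients with the powers of [z <= 1] discarded. *)
  apply Rle_trans with (z * 15); [apply Rmult_le_compat_l; nra | lra].
Qed.

Lemma conf_grad_bound k : Rabs (conf_grad m x k) <= 64 * m / s ^ 2.
Proof.
  pose proof r_pos. pose proof phi3_bounds. pose proof (inv_r_pow 2) as Hi.
  pose proof s_ge_1.
  assert (E : conf_grad m x k = (2 * m * phi ^ 3 * (x k / r)) * - / r ^ 2).
  { unfold conf_grad. fold r. fold phi. field. lra. }
  rewrite E.
  assert (Hx : Rabs (x k / r) <= 1).
  { unfold Rdiv. rewrite Rabs_mult, (Rabs_pos_eq (/ r))
      by (left; apply Rinv_0_lt_compat; assumption).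
    apply (Rmult_le_reg_r r); [assumption |]. rewrite Rmult_assoc, Rinv_l by lra.
    generalize (Rabs_le_norm3 x k). fold r. lra. }
  replace (64 * m / s ^ 2) with (16 * m * (2 ^ 2 / s ^ 2)) by (field; lra).
  apply Rabs_mult_le.
  - apply Rabs_mult_le_1; [| assumption].
    rewrite Rabs_pos_eq by nra. nra.
  - rewrite Rabs_Ropp, Rabs_pos_eq; [assumption |].
    left. apply Rinv_0_lt_compat, pow_lt. assumption.
Qed.

Lemma e_bound i j : Mdom r0 x -> Rabs (e x i j) <= 4 * K * m / s ^ 2.
Proof.
  intros Hx. pose proof r_pos. pose proof (inv_r_pow 2) as Hi. pose proof Km_nonneg.
  pose proof s_ge_1.
  specialize (He0 x i j Hx). fold r in He0.
  apply Rle_trans with (K * m / r ^ 2).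
  - apply Rle_div_of_mul; [apply pow_lt |]; assumption.
  - replace (4 * K * m / s ^ 2) with (K * m * (2 ^ 2 / s ^ 2)) by (field; lra).
    apply Rmult_le_compat_l; assumption.
Qed.

Lemma De_bound k i j : Mdom r0 x -> Rabs (De (k :: nil) x i j) <= 8 * K * m / s ^ 3.
Proof.
  intros Hx. pose proof r_pos. pose proof (inv_r_pow 3) as Hi. pose proof Km_nonneg.
  pose proof s_ge_1.
  specialize (He1 x k i j Hx). fold r in He1.
  apply Rle_trans with (K * m / r ^ 3).
  - apply Rle_div_of_mul; [apply pow_lt |]; assumption.
  - replace (8 * K * m / s ^ 3) with (K * m * (2 ^ 3 / s ^ 3)) by (field; lra).
    apply Rmult_le_compat_l; assumption.
Qed.

(** [mean_curv_expansion] in the frame scaled by [s], with [d = (KO + 192) * m / s] and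
    [eps = 216 * K * m / s ^ 2], then multiplied by [s]. The Schwarzschild term is [- s * P i3], the
    normal derivative of the conformal factor. *)
Lemma jacobi_approx :
  Rabs (DOm (false :: false :: nil) u v + DOm (true :: true :: nil) u v
        + 2 * (sech v * sech v) * Om u v
        + 2 * m * phi ^ 3 * s ^ 2 * (c * dilation_jacobi v + Om u v) / r ^ 3)
  <= 20000000000000 * ((KO + 192) ^ 2 * m + 216 * K) * m / s.
Proof.
  destruct Hmin as (HM & DF & HF0 & HF1 & _ & _ & HH).
  specialize (HM u v). fold x in HM.
  destruct (HH u v) as (dG & HdG & Hmc). clear HH.
  destruct HOm as (_ & HO0 & HO1 & _).
  assert (Hcp : 0 < c) by lra.
  rewrite (DF_u_comb c Om DOm Hcp HO0 HO1 DF HF0 HF1 u v) in Hmc.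
  rewrite (DF_v_comb c Om DOm Hcp HO0 HO1 DF HF0 HF1 u v) in Hmc.
  rewrite (DF_uu_comb c Om DOm Hcp HO0 HO1 DF HF0 HF1 u v) in Hmc.
  rewrite (DF_uv_comb c Om DOm Hcp HO0 HO1 DF HF0 HF1 u v) in Hmc.
  rewrite (DF_vu_comb c Om DOm Hcp HO0 HO1 DF HF0 HF1 u v) in Hmc.
  rewrite (DF_vv_comb c Om DOm Hcp HO0 HO1 DF HF0 HF1 u v) in Hmc.
  fold s in Hmc. fold x in Hmc, HdG.
  pose proof s_ge_1 as Hs. pose proof r_pos as Hr. pose proof Km_nonneg as HKm.
  pose proof KOm_nonneg as HKOm.
  apply mean_curv_vanishes_comb in Hmc; [| lra].
  assert (EdG : dG = fun k i j => conf_grad m x k * kron i j + De (k :: nil) x i j).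
  { apply functional_extensionality; intros k.
    apply functional_extensionality; intros i.
    apply functional_extensionality; intros j.
    destruct (He i j) as (H0 & H1 & _).
    eapply metric_partial; [exact Hr0 | exact HM | exact H0 | | apply HdG].
    apply (H1 nil); [cbn; lia | exact HM]. }
  rewrite EdG in Hmc.
  set (P := fun a => s * sum3 (fun k => conf_grad m x k * cat_frame u v a k)).
  assert (Hsi : 0 < / s) by (apply Rinv_0_lt_compat; lra).
  assert (Hsi1 : / s <= 1) by (rewrite <- Rinv_1; apply Rinv_le_contravar; lra).
  assert (HsOm : forall a, (length a <= 2)%nat ->
     Rabs (DOm a u v / s) <= (KO + 192) * m / s).
  { intros a Ha. apply Rabs_div_le; [lra |]. generalize (HOmb a u v Ha). lra. }
  assert (HD : 0 <= (KO + 192) * m / s)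
    by (apply Rmult_le_pos; lra).
  assert (HE : 0 <= 216 * K * m / s ^ 2).
  { apply Rmult_le_pos; [lra |]. left. apply Rinv_0_lt_compat, pow_lt. lra. }
  match type of Hmc with mean_curv_vanishes ?g ?dg _ _ _ _ _ _ =>
  pose proof (mean_curv_expansion ((KO + 192) * m / s) (216 * K * m / s ^ 2)
    (sech v) (tanh v) (phi ^ 4 - 1) (DOm nil u v / s) (DOm (false :: nil) u v / s)
    (DOm (true :: nil) u v / s) (DOm (false :: false :: nil) u v / s)
    (DOm (false :: true :: nil) u v / s) (DOm (true :: false :: nil) u v / s)
    (DOm (true :: true :: nil) u v / s) g P dg HD HE) as HJ end.
  (* Minimality, the last premise, is supplied beforehand so that only size conditions remain. *)
  assert (HJ' := fun H1 H2 H3 H4 H5 H6 H7 H8 H9 H10 H11 H12 H13 H14 =>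
    HJ H1 H2 H3 H4 H5 H6 H7 H8 H9 H10 H11 H12 H13 H14 Hmc). clear HJ.
  assert (HP3 : P i3 = s * (- 2 * m * phi ^ 3 / r ^ 3) * (c * dilation_jacobi v + Om u v)).
  { unfold P. rewrite <- graph_dot_normal. fold x. unfold conf_grad, sum3. fold r phi.
    unfold Rdiv. ring. }
  match type of HJ' with ?A1 -> ?A2 -> ?A3 -> ?A4 -> ?A5 -> _ =>
    assert (B1 : A1); [| assert (B2 : A2); [| assert (B3 : A3); [|
    assert (B4 : A4); [| assert (B5 : A5)]]]] end.
  - assert ((KO + 192) * m / s <= (KO + 192) * m * 1)
      by (apply Rmult_le_compat_l; lra).
    assert (216 * K * m / s ^ 2 <= 216 * K * m * 1).
    { apply Rmult_le_compat_l; [lra |]. rewrite <- Rinv_1.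
      apply Rinv_le_contravar; [lra |]. nra. }
    lra.
  - generalize (sech_bounds v); lra.
  - apply tanh_abs_le_1.
  - apply tau_bound.
  - intros a. unfold P.
    (* [192 = 3 * 64]: three coordinates, with [conf_grad_bound] for each. *)
    replace ((KO + 192) * m / s) with (KO * m * / s + s * (3 * (64 * m / s ^ 2)))
      by (field; lra).
    assert (0 <= KO * m * / s) by (apply Rmult_le_pos; lra).
    rewrite Rabs_mult, (Rabs_pos_eq s) by lra.
    assert (Rabs (sum3 (fun k => conf_grad m x k * cat_frame u v a k))
      <= 3 * (64 * m / s ^ 2)).
    { apply sum3_bound. intros k. apply Rabs_mult_le_1;
        [apply conf_grad_bound | apply cat_frame_le_1]. }
    assert (s * Rabs (sum3 (fun k => conf_grad m x k * cat_frame u v a k))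
      <= s * (3 * (64 * m / s ^ 2))) by (apply Rmult_le_compat_l; lra).
    lra.
  - specialize (HJ' B1 B2 B3 B4 B5).
    repeat match type of HJ' with Rabs (DOm ?a u v / s) <= _ -> _ =>
      specialize (HJ' (HsOm a ltac:(cbn; lia))) end.
    match type of HJ' with ?A1 -> ?A2 -> _ => assert (B6 : A1); [| assert (B7 : A2)] end.
    + intros i j. unfold metric. rewrite bilin_conformal, cat_frame_orthonormal.
      fold r phi.
      replace (phi ^ 4 * kron i j + bilin (e x) (cat_frame u v i) (cat_frame u v j) -
        (1 + (phi ^ 4 - 1)) * kron i j)
        with (bilin (e x) (cat_frame u v i) (cat_frame u v j)) by ring.
      apply Rle_trans with (9 * (4 * K * m / s ^ 2)).
      * apply bilin_bound; intros; try apply cat_frame_le_1. now apply e_bound.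
      * replace (216 * K * m / s ^ 2) with (54 * (4 * K * m / s ^ 2)) by (field; lra).
        assert (0 <= 4 * K * m / s ^ 2)
          by (replace (4 * K * m / s ^ 2) with (/ 54 * (216 * K * m / s ^ 2)) by (field; lra);
              apply Rmult_le_pos; lra).
        lra.
    + intros a b d. rewrite tri_conformal, cat_frame_orthonormal.
      unfold P.
      match goal with |- Rabs ?y <= _ => replace y with
        (s * tri (fun k i j => De (k :: nil) x i j) (cat_frame u v a) (cat_frame u v b)
               (cat_frame u v d)) by ring end.
      rewrite Rabs_mult, (Rabs_pos_eq s) by lra.
      (* [216 = 27 * 8]: the 27 terms of [tri], with [De_bound] for each; this dominates the [9 * 4]
         needed for [e] itself. *)
      replace (216 * K * m / s ^ 2) with (s * (27 * (8 * K * m / s ^ 3))) by (field; lra).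
      apply Rmult_le_compat_l; [lra |].
      apply tri_bound; intros; try apply cat_frame_le_1. now apply De_bound.
    + specialize (HJ' B6 B7). rewrite HP3, HO0 in HJ'.
      match type of HJ' with Rabs ?y <= ?z =>
        match goal with |- Rabs ?y' <= ?z' =>
          replace y' with (s * y) by (field; lra);
          replace z' with (s * z) by (field; lra) end end.
      rewrite Rabs_mult, (Rabs_pos_eq s) by lra.
      apply Rmult_le_compat_l; lra.
Qed.

Let jac := DOm (false :: false :: nil) u v + DOm (true :: true :: nil) u v
        + 2 * (sech v * sech v) * Om u v.
Let chi := dilation_jacobi v.

Lemma jacobi_test :
  chi * jac <= - (2 * m * s ^ 2 * c * chi ^ 2 / r ^ 3)
    + Rabs chi * (jacobi_const KO * m + 216 * 20000000000000 * K) * m / s.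
Proof.
  pose proof jacobi_approx as H. fold jac chi in H.
  pose proof s_ge_1 as Hs. pose proof r_pos as Hr. pose proof phi3_bounds as Hphi.
  pose proof Om_bound as HO. pose proof (inv_r_pow 3) as Hi.
  assert (Hir : 0 < / r ^ 3) by (apply Rinv_0_lt_compat, pow_lt; assumption).
  set (y := s ^ 2 / r ^ 3).
  assert (Hs2 : 0 < s ^ 2) by (apply pow_lt; lra).
  assert (Hy0 : 0 <= y) by (apply Rmult_le_pos; lra).
  assert (Hy1 : y <= 8 / s).
  { replace (8 / s) with (s ^ 2 * (2 ^ 3 / s ^ 3)) by (field; lra).
    apply Rmult_le_compat_l; lra. }
  set (f := phi ^ 3) in *.
  set (B := 20000000000000 * ((KO + 192) ^ 2 * m + 216 * K) * m / s) in *.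
  replace (2 * m * f * s ^ 2 * (c * chi + Om u v) / r ^ 3)
    with (2 * m * f * y * (c * chi + Om u v)) in H by (unfold y; field; lra).
  set (err := jac + 2 * m * f * y * (c * chi + Om u v)) in *.
  assert (E : chi * jac = - (2 * m * f * y * c * chi ^ 2)
     + (chi * (2 * m * (f * (y * - Om u v))) + chi * err)) by (unfold err; ring).
  rewrite E. apply Rplus_le_compat.
  - replace (2 * m * s ^ 2 * c * chi ^ 2 / r ^ 3) with (1 * (2 * m * y * c * chi ^ 2))
      by (unfold y; field; lra).
    replace (2 * m * f * y * c * chi ^ 2) with (f * (2 * m * y * c * chi ^ 2)) by ring.
    apply Ropp_le_contravar, Rmult_le_compat_r; [| lra].
    pose proof (pow2_ge_0 chi). repeat (apply Rmult_le_pos; [| lra]). lra.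
  - replace (Rabs chi * (jacobi_const KO * m + 216 * 20000000000000 * K) * m / s)
      with (Rabs chi * (2 * m * (8 * (8 / s * (KO * m)))) + Rabs chi * B)
      by (unfold B, jacobi_const; field; lra).
    apply Rplus_le_compat; (eapply Rle_trans; [apply Rle_abs |]);
      (apply Rabs_mult_le; [lra |]); [| assumption].
    apply Rabs_mult_le; [rewrite Rabs_pos_eq; lra |].
    apply Rabs_mult_le; [rewrite Rabs_pos_eq; lra |].
    apply Rabs_mult_le; [rewrite Rabs_pos_eq; lra |].
    now rewrite Rabs_Ropp.
Qed.

Let kappa := (jacobi_const KO * m + 216 * 20000000000000 * K) / c.

Lemma jacobi_test_error :
  Rabs chi * (jacobi_const KO * m + 216 * 20000000000000 * K) * m / s
  <= m * kappa * (128 / (1 + v ^ 2)).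
Proof.
  pose proof s_ge_1 as Hs.
  assert (Hk : 0 <= kappa).
  { unfold kappa, jacobi_const. apply Rmult_le_pos.
    - apply Rplus_le_le_0_compat; [| lra]. apply Rmult_le_pos; [| lra].
      pose proof (pow2_ge_0 (KO + 192)). lra.
    - left. apply Rinv_0_lt_compat. lra. }
  replace (Rabs chi * (jacobi_const KO * m + 216 * 20000000000000 * K) * m / s)
    with (m * kappa * (Rabs chi * sech v)).
  - apply Rmult_le_compat_l; [apply Rmult_le_pos; lra |]. apply jacobi_sech_bound.
  - unfold kappa, sech, s. pose proof (cosh_neq_0 v). field. split; [assumption | lra].
Qed.

Lemma jacobi_test_le : chi * jac <= m * kappa * (128 / (1 + v ^ 2)).
Proof.
  pose proof jacobi_test as H. pose proof jacobi_test_error.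
  pose proof s_ge_1 as Hs. pose proof r_pos as Hr.
  assert (0 <= 2 * m * s ^ 2 * c * chi ^ 2 / r ^ 3).
  { apply Rmult_le_pos; [| left; apply Rinv_0_lt_compat, pow_lt; assumption].
    pose proof (pow2_ge_0 chi). pose proof (pow2_ge_0 s).
    repeat (apply Rmult_le_pos; [| lra]). lra. }
  lra.
Qed.

(** On this interval [chi >= / 2], [cosh v <= 2] and [r <= 2 * s]. The ratio [c / s] equals
    [sech v], so the gain [m / 32] does not shrink as [c] grows. *)
Lemma jacobi_test_neg : 0 <= v <= / 2 ->
  chi * jac <= - (m / 32) + m * kappa * (128 / (1 + v ^ 2)).
Proof.
  intros Hv. pose proof jacobi_test as H. pose proof jacobi_test_error.
  pose proof s_ge_1 as Hs. pose proof r_pos as Hr. pose proof (r_upper Hv) as Hru.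
  assert (m / 32 <= 2 * m * s ^ 2 * c * chi ^ 2 / r ^ 3); [| lra].
  assert (Hchi : / 4 <= chi ^ 2).
  { unfold chi, dilation_jacobi. pose proof (tanh_abs_le_1 v) as HT.
    apply Rabs_le_between in HT. assert (v * tanh v <= / 2) by nra. nra. }
  apply Rle_trans with (2 * m * s ^ 2 * c * chi ^ 2 / (2 * s) ^ 3).
  - replace (2 * m * s ^ 2 * c * chi ^ 2 / (2 * s) ^ 3) with (m * (chi ^ 2 * / cosh v / 4)).
    + pose proof (cosh_half_le_2 v Hv). pose proof (cosh_ge_1 v).
      assert (/ 2 <= / cosh v) by (apply Rinv_le_contravar; lra).
      assert (/ 4 * / 2 <= chi ^ 2 * / cosh v) by (apply Rmult_le_compat; lra).
      replace (m / 32) with (m * (/ 4 * / 2 / 4)) by field.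
      apply Rmult_le_compat_l; lra.
    + unfold s. pose proof (cosh_neq_0 v). field. split; [assumption | lra].
  - apply Rdiv_le_compat_l.
    + pose proof (pow2_ge_0 chi). pose proof (pow2_ge_0 s).
    repeat (apply Rmult_le_pos; [| lra]). lra.
    + apply pow_lt; assumption.
    + apply pow_incr. lra.
Qed.
End Point.
End Pointwise.

(** * Averages and the Wronskian *)


Lemma derive_le_increment f f' a b k : a <= b ->
  (forall t, a <= t <= b -> derivable_pt_lim f t (f' t)) ->
  (forall t, a <= t <= b -> f' t <= k) -> f b - f a <= k * (b - a).
Proof.
  intros [Hab | ->] Hd Hk; [| lra].
  destruct (MVT_cor2 f f' a b Hab Hd) as (x & -> & Hx).
  apply Rmult_le_compat_r; [lra | apply Hk; lra].
Qed.

(** The decay hypothesis lets [V] depend on [u]. The bounded [u]-derivative carries decay across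
    steps of length [h], and finitely many steps cover [[0, L]]. *)
Lemma uniform_decay Om DOm : Cb2 Om DOm -> decays_at_ends Om ->
  forall L eps, 0 < eps -> exists V, forall u v, 0 <= u <= L -> V < Rabs v ->
    Rabs (Om u v) <= eps.
Proof.
  intros (_ & H0 & H1 & _ & K & HK) Hdec L eps Heps.
  assert (HK0 : 0 <= K).
  { generalize (HK nil 0 0 ltac:(cbn; lia)) (Rabs_pos (DOm nil 0 0)). lra. }
  (* [K + 1] keeps the denominator positive and still gives [K * h <= eps / 2]. *)
  set (h := eps / (2 * (K + 1))).
  assert (Hh : 0 < h) by (apply Rdiv_lt_0_compat; lra).
  assert (HKh : K * h <= eps / 2).
  { replace (eps / 2) with ((K + 1) * h) by (unfold h; field; lra). nra. }
  assert (HN : forall N, exists V, forall u v, 0 <= u <= INR N * h -> V < Rabs v ->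
    Rabs (Om u v) <= eps).
  { induction N as [| N [V IH]].
    - destruct (Hdec 0 eps Heps) as (V & HV). exists V. intros u v Hu Hv.
      simpl in Hu. replace u with 0 by lra. left. now apply HV.
    - destruct (Hdec (INR N * h) (eps / 2) ltac:(lra)) as (V' & HV').
      exists (Rmax V V'). intros u v Hu Hv.
      pose proof (Rmax_l V V'). pose proof (Rmax_r V V').
      destruct (Rle_dec u (INR N * h)) as [Hle | Hgt]; [apply IH; lra |].
      apply Rnot_le_lt in Hgt. rewrite S_INR in Hu.
      destruct (MVT_cor2 (fun t => DOm nil t v) (fun t => DOm (false :: nil) t v)
        (INR N * h) u Hgt) as (z & Hz & _).
      { intros t _. exact (H1 nil false t v ltac:(cbn; lia)). }
      cbv beta in Hz. rewrite !H0 in Hz.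
      specialize (HV' v ltac:(lra)).
      replace (Om u v) with (Om (INR N * h) v + (Om u v - Om (INR N * h) v)) by ring.
      eapply Rle_trans; [apply Rabs_triang |]. rewrite Hz.
      assert (Rabs (DOm (false :: nil) z v * (u - INR N * h)) <= K * h).
      { apply Rabs_mult_le; [apply HK; cbn; lia |]. rewrite Rabs_pos_eq; lra. }
      lra. }
  destruct (INR_unbounded (L / h)) as (N & HNL).
  destruct (HN N) as (V & HV). exists V. intros u v Hu Hv. apply HV; [| assumption].
  assert (L <= INR N * h).
  { replace L with (L / h * h) by (field; lra). apply Rmult_le_compat_r; lra. }
  lra.
Qed.

Definition dilation_jacobi' (v : R) : R := - tanh v - v * (sech v * sech v).

Lemma derive_dilation_jacobi v :
  derivable_pt_lim dilation_jacobi v (dilation_jacobi' v).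
Proof.
  unfold dilation_jacobi. eapply derivable_pt_lim_eq; [derive |].
  cbv beta. unfold dilation_jacobi'. ring.
Qed.

Lemma derive_dilation_jacobi' v :
  derivable_pt_lim dilation_jacobi' v (- (2 * (sech v * sech v) * dilation_jacobi v)).
Proof.
  unfold dilation_jacobi'. eapply derivable_pt_lim_eq; [derive |].
  cbv beta. unfold dilation_jacobi. ring.
Qed.

Lemma dilation_jacobi_bound v : 1 <= Rabs v -> Rabs (dilation_jacobi v) <= 2 * Rabs v.
Proof.
  intros Hv. unfold dilation_jacobi. eapply Rle_trans; [apply Rabs_triang |].
  rewrite Rabs_R1, Rabs_Ropp.
  assert (Rabs (v * tanh v) <= Rabs v) by (apply Rabs_mult_le_1; [lra | apply tanh_abs_le_1]).
  lra.
Qed.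

Lemma dilation_jacobi'_bound v : Rabs (dilation_jacobi' v) <= 3.
Proof.
  unfold dilation_jacobi'. eapply Rle_trans; [apply Rabs_triang |].
  rewrite !Rabs_Ropp. pose proof (tanh_abs_le_1 v). pose proof (sech_bounds v).
  assert (Hv : Rabs (v * sech v) <= 2).
  { rewrite Rabs_mult, (Rabs_pos_eq (sech v)) by lra. unfold sech.
    pose proof (cosh_ge_1 v).
    apply (Rmult_le_reg_r (cosh v)); [lra |]. rewrite Rmult_assoc, Rinv_l by lra.
    rewrite <- cosh_Rabs. unfold cosh.
    pose proof (exp_ineq1_le (Rabs v)). pose proof (exp_pos (- Rabs v)). lra. }
  replace (v * (sech v * sech v)) with (v * sech v * sech v) by ring.
  assert (Rabs (v * sech v * sech v) <= 2)
    by (apply Rabs_mult_le_1; [assumption | rewrite Rabs_pos_eq; lra]).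
  lra.
Qed.

Section Average.
Variables (Om : R -> R -> R) (DOm : list bool -> R -> R -> R).
Hypothesis HOm : Cb2 Om DOm.

(** Left unnormalised; the factor [2 * PI] is carried in the bounds. *)
Definition mean_u (a : list bool) (v : R) : R := RInt (fun u => DOm a u v) 0 (2 * PI).

Lemma continuous_u a u v : (length a <= 2)%nat -> continuous (fun t => DOm a t v) u.
Proof.
  intros Ha. destruct HOm as (_ & _ & _ & Hc & _).
  apply continuity_pt_filterlim. intros eps Heps.
  destruct (Hc a u v Ha eps Heps) as (d & Hd & H). exists d. split; [assumption |].
  intros t [_ Ht]. apply H; [exact Ht |]. rewrite Rminus_diag, Rabs_R0. exact Hd.
Qed.

Lemma ex_RInt_u a v : (length a <= 2)%nat -> ex_RInt (fun u => DOm a u v) 0 (2 * PI).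
Proof. intros Ha. apply (ex_RInt_continuous (V := R_CompleteNormedModule)). intros u _. now apply continuous_u. Qed.

Lemma derive_mean_u a v : (length a <= 1)%nat ->
  derivable_pt_lim (mean_u a) v (mean_u (true :: a) v).
Proof.
  intros Ha. destruct HOm as (_ & _ & Hd & Hc & _).
  assert (HD : forall u t, is_derive (fun z => DOm a u z) t (DOm (true :: a) u t)).
  { intros u t. apply is_derive_Reals. exact (Hd a true u t Ha). }
  assert (HE : forall u t, Derive (fun z => DOm a u z) t = DOm (true :: a) u t)
    by (intros; apply is_derive_unique, HD).
  apply is_derive_Reals. unfold mean_u.
  replace (RInt (fun u => DOm (true :: a) u v) 0 (2 * PI))
    with (RInt (fun u => Derive (fun z => DOm a u z) v) 0 (2 * PI))
    by (apply RInt_ext; intros; apply HE).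
  apply (is_derive_RInt_param (fun v u => DOm a u v)).
  - exists (mkposreal 1 Rlt_0_1). intros t _ u _. eexists. apply HD.
  - intros u _ eps.
    destruct (Hc (true :: a) u v ltac:(cbn; lia) eps (cond_pos eps)) as (d & Hdp & H).
    exists (mkposreal d Hdp). intros y z Hy Hz. rewrite !HE. apply H; assumption.
  - exists (mkposreal 1 Rlt_0_1). intros t _. apply ex_RInt_u. lia.
Qed.

(** Periodicity is given for [Om] only and passes to the derivative through difference quotients. *)
Lemma periodic_u v : DOm (false :: nil) (2 * PI) v = DOm (false :: nil) 0 v.
Proof.
  destruct HOm as (Hp & H0 & Hd & _).
  eapply uniqueness_limite; [| exact (Hd nil false 0 v ltac:(cbn; lia))].
  intros eps Heps. destruct (Hd nil false (2 * PI) v ltac:(cbn; lia) eps Heps) as (d & H).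
  exists d. intros h Hh Hh'. specialize (H h Hh Hh').
  rewrite !H0 in *. rewrite <- (Hp (0 + h)), <- (Hp 0), Rplus_0_l.
  replace (h + 2 * PI) with (2 * PI + h) by ring. now rewrite Rplus_0_l.
Qed.

Lemma is_RInt_uu v : is_RInt (fun u => DOm (false :: false :: nil) u v) 0 (2 * PI) 0.
Proof.
  destruct HOm as (_ & _ & Hd & _).
  replace 0 with (minus (DOm (false :: nil) (2 * PI) v) (DOm (false :: nil) 0 v)) at 2.
  - apply (is_RInt_derive (V := R_CompleteNormedModule) (fun u => DOm (false :: nil) u v)).
    + intros u _. apply is_derive_Reals. exact (Hd (false :: nil) false u v ltac:(cbn; lia)).
    + intros u _. apply continuous_u. cbn; lia.
  - rewrite periodic_u. apply (minus_eq_zero (G := R_AbelianGroup)).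
Qed.

Definition wronskian (v : R) : R :=
  dilation_jacobi v * mean_u (true :: nil) v - dilation_jacobi' v * mean_u nil v.

Lemma derive_wronskian v : derivable_pt_lim wronskian v
  (dilation_jacobi v *
    (mean_u (true :: true :: nil) v + 2 * (sech v * sech v) * mean_u nil v)).
Proof.
  pose proof (derive_dilation_jacobi v). pose proof (derive_dilation_jacobi' v).
  pose proof (derive_mean_u nil v ltac:(cbn; lia)).
  pose proof (derive_mean_u (true :: nil) v ltac:(cbn; lia)).
  unfold wronskian. eapply derivable_pt_lim_eq; [derive |]. cbv beta. ring.
Qed.

(** Integration over the circle, where the [uu] term drops out by periodicity and
    [dilation_jacobi v] is a constant. *)
Lemma derive_wronskian_le v M :
  (forall u, dilation_jacobi v *
     (DOm (false :: false :: nil) u v + DOm (true :: true :: nil) u v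
        + 2 * (sech v * sech v) * Om u v) <= M) ->
  dilation_jacobi v *
    (mean_u (true :: true :: nil) v + 2 * (sech v * sech v) * mean_u nil v) <= 2 * PI * M.
Proof.
  intros HM. pose proof PI_RGT_0.
  replace (2 * PI * M) with (scal (2 * PI - 0) M)
    by (unfold scal; simpl; unfold mult; simpl; ring).
  eapply is_RInt_le; [| | apply (is_RInt_const (V := R_NormedModule)) | intros u _; apply HM].
  - lra.
  - replace (mean_u (true :: true :: nil) v + _)
      with (0 + mean_u (true :: true :: nil) v + 2 * (sech v * sech v) * mean_u nil v) by ring.
    apply (is_RInt_scal (V := R_NormedModule)).
    apply (is_RInt_plus (V := R_NormedModule)).
    + apply (is_RInt_plus (V := R_NormedModule)); [apply is_RInt_uu |].
      apply (RInt_correct (V := R_CompleteNormedModule)), ex_RInt_u. cbn; lia.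
    + apply (is_RInt_scal (V := R_NormedModule)).
      apply (is_RInt_ext (fun u => DOm nil u v)).
      * intros u _. apply HOm.
      * apply (RInt_correct (V := R_CompleteNormedModule)), ex_RInt_u. cbn; lia.
Qed.

Hypothesis Hdec : decays_at_ends Om.

Lemma mean_u_decay eps : 0 < eps ->
  exists V, forall v, V < Rabs v -> Rabs (mean_u nil v) <= eps.
Proof.
  intros Heps. pose proof PI_RGT_0.
  destruct (uniform_decay Om DOm HOm Hdec (2 * PI) (eps / (2 * PI))) as (V & HV).
  { apply Rdiv_lt_0_compat; lra. }
  exists V. intros v Hv.
  replace eps with ((2 * PI - 0) * (eps / (2 * PI))) by (field; lra).
  apply abs_RInt_le_const; [lra | apply ex_RInt_u; cbn; lia |].
  intros u Hu. destruct HOm as (_ & H0 & _). rewrite H0. now apply HV.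
Qed.

(* The mean value theorem on [[a, b]] gives a point where [v * mean_u' v] is small,
   without any decay of derivatives. *)
Lemma wronskian_small_near eps a b : 0 < eps -> a < b ->
  (forall v, a <= v <= b -> b - a <= Rabs v <= 2 * (b - a)) -> 1 <= b - a ->
  (forall v, a <= v <= b -> Rabs (mean_u nil v) <= eps) ->
  exists v, a <= v <= b /\ Rabs (wronskian v) <= 11 * eps.
Proof.
  intros Heps Hab Hv H1 HA.
  destruct (MVT_cor2 (mean_u nil) (mean_u (true :: nil)) a b Hab) as (x & Hx & Hx').
  { intros t _. apply derive_mean_u. cbn; lia. }
  exists x. split; [lra |].
  assert (HA2 : Rabs (mean_u (true :: nil) x) * (b - a) <= 2 * eps).
  { rewrite <- (Rabs_pos_eq (b - a)), <- Rabs_mult, <- Hx by lra.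
    generalize (HA a ltac:(lra)) (HA b ltac:(lra))
      (Rabs_triang (mean_u nil b) (- mean_u nil a)). rewrite Rabs_Ropp.
    unfold Rminus. lra. }
  specialize (Hv x ltac:(lra)). specialize (HA x ltac:(lra)).
  unfold wronskian. eapply Rle_trans; [apply Rabs_triang |]. rewrite Rabs_Ropp.
  assert (Rabs (dilation_jacobi' x * mean_u nil x) <= 3 * eps)
    by (apply Rabs_mult_le; [apply dilation_jacobi'_bound | assumption]).
  assert (Rabs (dilation_jacobi x * mean_u (true :: nil) x) <= 8 * eps).
  { pose proof (dilation_jacobi_bound x ltac:(lra)).
    pose proof (Rabs_pos (mean_u (true :: nil) x)).
    apply Rle_trans with (4 * (b - a) * Rabs (mean_u (true :: nil) x)); [| lra].
    apply Rabs_mult_le; lra. }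
  lra.
Qed.

(** On [[B, 2 * B]] and its mirror image [Rabs v] is comparable to the length of the interval, as
    [wronskian_small_near] requires. *)
Lemma wronskian_small eps : 0 < eps ->
  exists V V', 1 <= V /\ 1 <= V' /\ Rabs (wronskian V) <= eps /\ Rabs (wronskian (- V')) <= eps.
Proof.
  intros Heps. destruct (mean_u_decay (eps / 11) ltac:(lra)) as (V0 & HV0).
  set (B := Rmax V0 0 + 1).
  assert (HB : V0 < B /\ 1 <= B)
    by (unfold B; pose proof (Rmax_l V0 0); pose proof (Rmax_r V0 0); lra).
  destruct (wronskian_small_near (eps / 11) B (2 * B)) as (x & Hx & Hw); try lra.
  { intros v Hv. rewrite Rabs_pos_eq; lra. }
  { intros v Hv. apply HV0. rewrite Rabs_pos_eq; lra. }
  destruct (wronskian_small_near (eps / 11) (- (2 * B)) (- B)) as (y & Hy & Hw'); try lra.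
  { intros v Hv. rewrite Rabs_left; lra. }
  { intros v Hv. apply HV0. rewrite Rabs_left; lra. }
  exists x, (- y). rewrite Ropp_involutive. lra.
Qed.

(** Subtracting [b * atan v] absorbs the error, so [Z] is nonincreasing and drops by at least
    [PI * m / 32] across [[0, / 2]]. The Wronskian values at the two ends permit a drop of only
    [PI * m / 128] and the [atan] term one of [PI * m / 64], which together fall short. *)
Lemma no_decaying_solution m kappa : 0 < m -> 0 <= kappa <= / 65536 ->
  let jac u v := DOm (false :: false :: nil) u v + DOm (true :: true :: nil) u v
        + 2 * (sech v * sech v) * Om u v in
  (forall u v, dilation_jacobi v * jac u v <= m * kappa * (128 / (1 + v ^ 2))) ->
  (forall u v, 0 <= v <= / 2 ->
     dilation_jacobi v * jac u v <= - (m / 32) + m * kappa * (128 / (1 + v ^ 2))) ->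
  False.
Proof.
  intros Hm Hk jac H1 H2. pose proof PI_RGT_0 as HPI. pose proof PI_4 as HPI4.
  set (b := 2 * PI * (m * kappa * 128)).
  set (Z := fun v => wronskian v - b * atan v).
  set (Z' := fun v => dilation_jacobi v *
    (mean_u (true :: true :: nil) v + 2 * (sech v * sech v) * mean_u nil v)
    - b * / (1 + v ^ 2)).
  assert (HZ : forall v, derivable_pt_lim Z v (Z' v)).
  { intros v. unfold Z, Z'. apply derive_minus; [apply derive_wronskian |].
    eapply derivable_pt_lim_eq.
    - apply derive_mult; [apply derive_const | apply derivable_pt_lim_atan].
    - cbv beta. unfold Rsqr. unfold Rdiv. simpl. rewrite Rmult_1_r. ring. }
  assert (Hle : forall v, Z' v <= 0).
  { intros v. unfold Z'. pose proof (derive_wronskian_le v _ (fun u => H1 u v)) as H.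
    unfold b. unfold Rdiv in H. lra. }
  assert (Hneg : forall v, 0 <= v <= / 2 -> Z' v <= - (PI * m / 16)).
  { intros v Hv. unfold Z'. pose proof (derive_wronskian_le v _ (fun u => H2 u v Hv)) as H.
    unfold b. unfold Rdiv in H. lra. }
  assert (Hpm : 0 < PI * m) by (apply Rmult_lt_0_compat; assumption).
  destruct (wronskian_small (PI * m / 256)) as (V & V' & HV & HV' & HW & HW'); [lra |].
  pose proof (derive_le_increment Z Z' (- V') 0 0 ltac:(lra) (fun t _ => HZ t) (fun t _ => Hle t)).
  pose proof (derive_le_increment Z Z' 0 (/ 2) _ ltac:(lra) (fun t _ => HZ t) Hneg).
  pose proof (derive_le_increment Z Z' (/ 2) V 0 ltac:(lra) (fun t _ => HZ t) (fun t _ => Hle t)).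
  apply Rabs_le_between in HW. apply Rabs_le_between in HW'.
  pose proof (atan_bound V). pose proof (atan_bound (- V')).
  assert (Hb0 : 0 <= b) by (unfold b; repeat (apply Rmult_le_pos; try lra)).
  assert (Hb : b * PI <= PI * m / 64).
  { assert (b * PI = PI * m * (PI * kappa * 256)) by (unfold b; ring).
    rewrite H6. unfold Rdiv. apply Rmult_le_compat_l; [lra |]. nra. }
  assert (b * (atan V - atan (- V')) <= b * PI) by (apply Rmult_le_compat_l; lra).
  unfold Z in *. lra.
Qed.
End Average.

(** * Linear bounds at [m = 0] *)


(** The data [De 0] are tied to [e 0] only through limits, so their vanishing rests on uniqueness of
    partial derivatives within the domain. *)
Lemma E2_zero_jet r0 (f : R3 -> R) Df : C2_within (Mdom r0) f Df ->
  (forall x, Mdom r0 x -> f x = 0) ->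
  forall a x, (length a <= 1)%nat -> Mdom r0 x -> Df a x = 0.
Proof.
  intros (H0 & H1 & _) Hf.
  assert (Hn : forall x, Mdom r0 x -> Df nil x = 0)
    by (intros x Hx; rewrite H0, Hf; auto).
  intros [| k [| l a]] x Ha Hx; [now apply Hn | | cbn in Ha; lia].
  eapply partial_within_unique; [exact Hx | exact (H1 nil k x ltac:(cbn; lia) Hx) |].
  intros eps Heps. exists 1. split; [lra |]. intros h [[Hh Hd] _].
  rewrite (Hn x Hx), (Hn _ Hd). unfold dist, Base, R_met, Rdist.
  replace ((0 - 0) / h - 0) with 0 by (field; assumption).
  rewrite Rabs_R0. exact Heps.
Qed.

Lemma Cb2_zero_jet f Df : Cb2 f Df -> (forall u v, f u v = 0) ->
  forall a u v, (length a <= 2)%nat -> Df a u v = 0.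
Proof.
  intros (_ & H0 & H1 & _) Hf. induction a as [| d a IH]; intros u v Ha.
  - now rewrite H0.
  - cbn in Ha. assert (Ha' : (length a <= 1)%nat) by lia.
    pose proof (H1 a d u v Ha') as H. destruct d; cbn in H;
      (eapply uniqueness_limite; [exact H |];
       eapply derivable_pt_lim_ext; [| apply (derive_const 0)];
       intros z; symmetry; apply IH; lia).
Qed.

(** The weight [n] is a power of [norm3 x] for the metrics and 1 for [Om]. *)
Lemma quotient_bound x y m n K : 0 < m -> 0 <= n -> Rabs y * n <= K ->
  Rabs ((x - 0) / m - y) * n <= 1 -> Rabs x * n <= (K + 1) * m.
Proof.
  intros Hm Hn Hy H.
  replace x with (m * ((x - 0) / m - y + y)) by (field; lra).
  rewrite Rabs_mult, (Rabs_pos_eq m) by lra.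
  pose proof (Rabs_triang ((x - 0) / m - y) y).
  assert (Rabs ((x - 0) / m - y + y) * n <= (Rabs ((x - 0) / m - y) + Rabs y) * n)
    by (apply Rmult_le_compat_r; lra).
  rewrite Rmult_assoc, (Rmult_comm (K + 1)). apply Rmult_le_compat_l; lra.
Qed.

(** Differentiability at 0 is used with tolerance 1: the constant is a bound on the derivative plus
    one. *)
Lemma E2_linear_bound r0 eps0 e De : 0 < r0 -> 0 < eps0 ->
  (forall m, 0 <= m <= eps0 -> is_E2 r0 (e m) (De m)) ->
  E2_curve_diff_at0 r0 eps0 De ->
  (forall x i j, Mdom r0 x -> e 0 x i j = 0) ->
  exists K d, 0 <= K /\ 0 < d /\ forall m, 0 < m -> m <= eps0 -> m < d ->
    forall a x i j, (length a <= 1)%nat -> Mdom r0 x ->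
      Rabs (De m a x i j) * norm3 x ^ (2 + length a) <= K * m.
Proof.
  intros Hr He0 HE (De' & (_ & _ & K & HK) & Hdiff) Hz.
  destruct (Hdiff 1 Rlt_0_1) as (d & Hd & H).
  exists (Rmax K 0 + 1), d. pose proof (Rmax_l K 0). pose proof (Rmax_r K 0).
  split; [lra |]. split; [assumption |].
  intros m Hm Hme Hmd a x i j Ha Hx.
  assert (Ha2 : (length a <= 2)%nat) by lia.
  specialize (H m Hm Hme Hmd a x i j Ha2 Hx). specialize (HK a x i j Ha2 Hx).
  destruct (HE 0 ltac:(lra)) as (HC & _ & _).
  assert (Z : De 0 a x i j = 0).
  { apply (E2_zero_jet r0 (fun x => e 0 x i j) (fun a x => De 0 a x i j)); auto. }
  unfold wE in *. rewrite Z in H.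
  eapply quotient_bound; [exact Hm | | | exact H].
  - apply pow_le, norm3_pos.
  - lra.
Qed.

Lemma Cb2_linear_bound eps0 Om DOm : 0 < eps0 ->
  (forall m, 0 <= m <= eps0 -> Cb2 (Om m) (DOm m)) ->
  Cb2_curve_diff_at0 eps0 DOm -> (forall u v, Om 0 u v = 0) ->
  exists K d, 0 <= K /\ 0 < d /\ forall m, 0 < m -> m <= eps0 -> m < d ->
    forall a u v, (length a <= 2)%nat -> Rabs (DOm m a u v) <= K * m.
Proof.
  intros He0 HC (D' & (_ & _ & _ & _ & K & HK) & Hdiff) Hz.
  destruct (Hdiff 1 Rlt_0_1) as (d & Hd & H).
  exists (Rmax K 0 + 1), d. pose proof (Rmax_l K 0). pose proof (Rmax_r K 0).
  split; [lra |]. split; [assumption |].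
  intros m Hm Hme Hmd a u v Ha.
  specialize (H m Hm Hme Hmd a u v Ha). specialize (HK a u v Ha).
  rewrite (Cb2_zero_jet _ _ (HC 0 ltac:(lra)) Hz a u v Ha) in H.
  rewrite <- (Rmult_1_r (Rabs _)). rewrite <- (Rmult_1_r (Rabs _)) in H.
  eapply quotient_bound; [exact Hm | lra | | exact H]. lra.
Qed.

Theorem theorem1p2 (r0 eps0 : R) (e : R -> R3 -> Mat)
  (De : R -> list idx -> R3 -> Mat) :
  0 < r0 -> 0 < eps0 ->
  (forall m, 0 <= m <= eps0 -> is_E2 r0 (e m) (De m)) ->
  E2_curve_continuous r0 eps0 De ->
  E2_curve_diff_at0 r0 eps0 De ->
  (forall x i j, Mdom r0 x -> e 0 x i j = 0) ->
  exists cbar, r0 <= cbar /\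
    ~ (exists (Om : R -> R -> R -> R) (DOm : R -> list bool -> R -> R -> R)
              (ms cs : nat -> R),
         (forall m, 0 <= m <= eps0 -> Cb2 (Om m) (DOm m)) /\
         Cb2_curve_continuous eps0 DOm /\
         Cb2_curve_diff_at0 eps0 DOm /\
         (forall u v, Om 0 u v = 0) /\
         (forall m, 0 <= m <= eps0 -> decays_at_ends (Om m)) /\
         Un_decreasing ms /\ Un_cv ms 0 /\
         (forall i, 0 < ms i < eps0) /\
         (forall i, cbar <= cs i) /\
         (forall i, minimal_immersion r0 (metric (ms i) (e (ms i)))
                                         (catenoid_graph (cs i) (Om (ms i))))).
Proof.
  intros Hr0 Heps0 HE _ HEd Hz.
  destruct (E2_linear_bound r0 eps0 e De Hr0 Heps0 HE HEd Hz) as (K & d1 & HK & Hd1 & HKb).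
  set (C2 := 216 * 20000000000000 * K).
  (* [131072 = 2 * 65536]: half of the bound on [kappa] goes to [C2 / c], which depends on [e] only.
     The lower bound 1 on [c] ensures [s >= 1]. *)
  exists (Rmax r0 (Rmax 1 (131072 * C2))). split; [apply Rmax_l |].
  intros (Om & DOm & ms & cs & HC & _ & HCd & HOz & Hdec & _ & Hcv & Hms & Hcs & Hmin).
  destruct (Cb2_linear_bound eps0 Om DOm Heps0 HC HCd HOz) as (KO & d2 & HKO & Hd2 & HKOb).
  assert (HJ : 0 <= jacobi_const KO)
    by (unfold jacobi_const; pose proof (pow2_ge_0 (KO + 192)); lra).
  (* [d3] meets the smallness condition of the expansion; [d4] gives the other half of the bound on
     [kappa] to the part depending on [Om]. *)
  set (d3 := / 100000000 / (KO + 192 + 216 * K)).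
  set (d4 := / 131072 / (jacobi_const KO + 1)).
  assert (Hd3 : 0 < d3) by (apply Rdiv_lt_0_compat; lra).
  assert (Hd4 : 0 < d4) by (apply Rdiv_lt_0_compat; lra).
  destruct (Hcv (Rmin (Rmin d1 d2) (Rmin d3 d4))) as (N & HN).
  { repeat apply Rmin_pos; assumption. }
  specialize (HN N (le_n N)). specialize (Hms N). specialize (Hcs N). specialize (Hmin N).
  set (m := ms N) in *. set (c := cs N) in *.
  unfold Rdist in HN. rewrite Rminus_0_r, Rabs_pos_eq in HN by lra.
  assert (Hm1 : m < d1 /\ m < d2 /\ m < d3 /\ m < d4).
  { pose proof (Rmin_l (Rmin d1 d2) (Rmin d3 d4)). pose proof (Rmin_r (Rmin d1 d2) (Rmin d3 d4)).
    pose proof (Rmin_l d1 d2). pose proof (Rmin_r d1 d2).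
    pose proof (Rmin_l d3 d4). pose proof (Rmin_r d3 d4). lra. }
  assert (Hc : 1 <= c /\ 131072 * C2 <= c).
  { pose proof (Rmax_r r0 (Rmax 1 (131072 * C2))).
    pose proof (Rmax_l 1 (131072 * C2)). pose proof (Rmax_r 1 (131072 * C2)). lra. }
  assert (Hsmall : (KO + 192) * m + 216 * K * m <= / 100000000).
  { replace (/ 100000000) with ((KO + 192 + 216 * K) * d3) by (unfold d3; field; lra).
    rewrite <- Rmult_plus_distr_r. apply Rmult_le_compat_l; lra. }
  assert (HJm : 0 <= jacobi_const KO * m <= / 131072).
  { split; [apply Rmult_le_pos; lra |].
    replace (/ 131072) with ((jacobi_const KO + 1) * d4) by (unfold d4; field; lra).
    apply Rmult_le_compat; lra. }
  assert (HC2 : 0 <= C2) by (unfold C2; lra).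
  set (kappa := (jacobi_const KO * m + C2) / c).
  assert (Hkap : 0 <= kappa <= / 65536).
  { unfold kappa. split.
    - apply Rmult_le_pos; [lra |]. left. apply Rinv_0_lt_compat. lra.
    - apply (Rmult_le_reg_r c); [lra |]. unfold Rdiv. rewrite Rmult_assoc, Rinv_l by lra.
      lra. }
  assert (Hmm : 0 <= m <= eps0) by lra.
  destruct (HE m Hmm) as (HEC & _ & _).
  assert (B0 : forall x i j, Mdom r0 x -> Rabs (e m x i j) * norm3 x ^ 2 <= K * m).
  { intros x i j Hx. destruct (HEC i j) as (H0 & _). rewrite <- (H0 x Hx).
    apply (HKb m ltac:(lra) ltac:(lra) ltac:(lra) nil); [cbn; lia | assumption]. }
  assert (B1 : forall x k i j, Mdom r0 x ->
    Rabs (De m (k :: nil) x i j) * norm3 x ^ 3 <= K * m).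
  { intros x k i j Hx.
    apply (HKb m ltac:(lra) ltac:(lra) ltac:(lra) (k :: nil)); [cbn; lia | assumption]. }
  assert (B2 := HKOb m ltac:(lra) ltac:(lra) ltac:(lra)).
  assert (Hm0 : 0 < m) by lra. destruct Hc as [Hc Hc'].
  apply (no_decaying_solution (Om m) (DOm m) (HC m Hmm) (Hdec m Hmm) m kappa Hm0 Hkap).
  - intros u v.
    exact (jacobi_test_le r0 m K KO c (e m) (De m) (Om m) (DOm m) Hr0 Hm0 HK HKO Hc
      HEC B0 B1 (HC m Hmm) B2 Hsmall Hmin u v).
  - intros u v.
    exact (jacobi_test_neg r0 m K KO c (e m) (De m) (Om m) (DOm m) Hr0 Hm0 HK HKO Hc
      HEC B0 B1 (HC m Hmm) B2 Hsmall Hmin u v).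
Qed.
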